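(* For any variety $\mathcal V$, the following are equivalent. (1) $\mathcal V$ is a Hobby-McKenzie variety. (2) For any compatible reflexive digraph in $\mathcal V$, the radical equivalence coincides with the extreme equivalence. (3) For any compatible reflexive digraph in $\mathcal V$, the strong equivalence coincides with the extreme equivalence. (4) For every positive integer $n$, in the digraph freely generated by $\mathbb C_n$ in $\mathcal V$, the weak component containing the vertices of $\mathbb C_n$ is extremely connected. (5) In the digraph freely generated by $\mathbb C_3$ in $\mathcal V$, the weak component containing the vertices of $\mathbb C_3$ is extremely connected. (6) There exist a positive integer $n$ and 6-ary terms $s_i,t_i$ ($1\le i\le n$) of $\mathcal V$ such that $\mathcal V$ satisfies $t_1(x,x,y,y,z,z)=x$; $t_i(x,x,y,y,z,z)=s_i(x,y,y,z,z,x)$ for all $1\le i\le n$; $s_i(x,x,y,y,z,z)=t_i(x,y,y,z,z,x)$ for all $1\le i\le n$; $t_i(x,x,y,y,z,z)=t_{i-1}(x,y,y,z,z,x)$ for all $1<i\le n$; $y=t_n(x,y,y,z,z,x)$.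
   Context: A digraph $\mathbb G$ is compatible in $\mathcal V$ if there is an algebra $\mathbf G\in\mathcal V$ with universe the vertex set $G$ such that the edge relation is a subuniverse of $\mathbf G^2$. For a reflexive digraph: the weak equivalence relates $a,b$ if joined by a sequence $a=a_0,\dots,a_n=b$ with $a_i\to a_{i+1}$ or $a_{i+1}\to a_i$ for each $i$ (classes: weak components); the strong equivalence relates $a,b$ if there are directed paths from $a$ to $b$ and from $b$ to $a$; the extreme equivalence relates $a,b$ if joined by a sequence with $a_i\to a_{i+1}$ and $a_{i+1}\to a_i$ for each $i$; a digraph is extremely connected if its extreme equivalence has one class. For an equivalence $\alpha$, $\mathbb G/\alpha$ has vertices $G/\alpha$ and edges $A\to B$ iff some $a\in A$, $b\in B$ have $a\to b$. The radical equivalence: $\nu_0$ is the extreme equivalence of $\mathbb G$; given $\nu_i$, let $\nu_i'$ be the extreme equivalence of $\mathbb G/\nu_i$ and $\nu_{i+1}=\{(a,b): a/\nu_i\ \nu_i'\ b/\nu_i\}$; the radical equivalence is $\bigcup_i\nu_i$. $\mathbb C_n$ is the reflexive directed $n$-cycle. The digraph freely generated by a digraph $\mathbb P$ in $\mathcal V$ has vertex set the free algebra $\mathbf F\in\mathcal V$ on free generating set $P$ and edge set the subalgebra of $\mathbf F^2$ generated by the edges of $\mathbb P$. $\mathcal V$ is Hobby-McKenzie if its full idempotent reduct (the variety whose operations are the idempotent terms of $\mathcal V$ with the identities they satisfy in $\mathcal V$) does not interpret in the variety of semilattices, i.e. there is no clone homomorphism from its term clone to the clone of semilattices; equivalently,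 $\mathcal V$ has an $m$-ary idempotent term $t$ such that for each $i\le m$, $\mathcal V$ satisfies an identity $t(x,\dots,x,x_{i+1},\dots,x_m)=t(y_1,\dots,y_{i-1},y,y_{i+1},\dots,y_m)$ with all $x_j,y_k\in\{x,y\}$. *)

(* Defs.v *)
From mathcomp Require Import all_boot.
From mathcomp Require Import boolp classical_sets.
From Stdlib Require Import Relations.Relation_Operators.

Set Implicit Arguments.
Unset Strict Implicit.
Unset Printing Implicit Defensive.

Local Open Scope classical_set_scope.

(* The set of the sets [R a]; when [R] is an equivalence relation this is the
   set T/R of its equivalence classes. *)
Definition quot (T : Type) (R : T -> set T) : Type :=
  {C : set T | exists a, C = R a}.

Definition cls (T : Type) (R : T -> set T) (a : T) : quot R :=
  exist _ (R a) (ex_intro _ a erefl).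

Definition rep (T : Type) (R : T -> set T) (c : quot R) : T :=
  sval (cid (svalP c)).

Lemma clsK (T : Type) (R : T -> set T) (c : quot R) : cls R (rep c) = c.
Proof.
rewrite /cls /rep; case: c => C hC /=; apply: eq_exist.
by case: (cid _).
Qed.

Record signature : Type := Signature { symb :> Type; arity : symb -> nat }.
Arguments arity {s}.

Inductive term (S : signature) (X : Type) : Type :=
| Var (x : X)
| App (o : S) (ts : 'I_(arity o) -> term S X).
Arguments Var {S X}.
Arguments App {S X}.

Fixpoint subst (S : signature) (X Y : Type) (f : X -> term S Y)
    (t : term S X) : term S Y :=
  match t with
  | Var x => f x
  | App o ts => App o (fun i => subst f (ts i))
  end.

Definition operations (S : signature) (A : Type) : Type :=
  forall o : S, ('I_(arity o) -> A) -> A.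

Record algebra (S : signature) : Type :=
  Algebra { carrier :> Type; ops : operations S carrier }.
Arguments ops {S}.

Fixpoint eval (S : signature) (A : algebra S) (X : Type) (v : X -> A)
    (t : term S X) : A :=
  match t with
  | Var x => v x
  | App o ts => ops A o (fun i => eval v (ts i))
  end.

(* A variety is presented by a signature and a set of identities. *)
Record variety : Type := Variety {
  sig :> signature;
  identities : set (term sig nat * term sig nat)
}.

(* The empty algebra is not excluded (when there are no nullary symbols); it
   satisfies all identities in at least one variable. *)
Definition in_variety (V : variety) (A : algebra V) : Prop :=
  forall e, identities e -> forall v : nat -> A, eval v e.1 = eval v e.2.

Definition satisfies (V : variety) (X : Type) (s t : term V X) : Prop :=
  forall A : algebra V, in_variety A -> forall v : X -> A, eval v s = eval v t.

Notation "V |= s ≈ t" := (@satisfies V _ s t)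
  (at level 70, s at level 69, t at level 69).

Definition subuniverse (S : signature) (A : algebra S) (B : set A) : Prop :=
  forall (o : S) (a : 'I_(arity o) -> A), (forall i, B (a i)) -> B (ops A o a).

Definition square (S : signature) (A : algebra S) : algebra S :=
  @Algebra S (A * A)
    (fun o a => (ops A o (fun i => (a i).1), ops A o (fun i => (a i).2))).

(* The free algebra of [V] on [X]: terms over [X] modulo the identities that
   hold in [V]. *)
Definition free_alg (V : variety) (X : Type) : algebra V :=
  @Algebra V (quot (@satisfies V X))
    (fun o a => cls (@satisfies V X) (App o (fun i => rep (a i)))).

Definition gen (V : variety) (X : Type) (x : X) : free_alg V X :=
  cls (@satisfies V X) (Var x).

Lemma eval_subst (S : signature) (A : algebra S) (X Y : Type)
    (f : X -> term S Y) (v : Y -> A) (t : term S X) :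
  eval v (subst f t) = eval (fun x => eval v (f x)) t.
Proof.
elim: t => //= o ts IH; congr (ops A o _); apply: funext => i; exact: IH.
Qed.

Lemma cls_satisfies (V : variety) (X : Type) (s t : term V X) :
  cls (@satisfies V X) s = cls (@satisfies V X) t <-> V |= s ≈ t.
Proof.
split=> [[E]|E]; first by rewrite E.
apply: eq_exist; apply/seteqP; split=> u /= h A hA v.
  by rewrite -(h A hA) (E A hA).
by rewrite -(h A hA) (E A hA).
Qed.

Lemma eval_free (V : variety) (X Y : Type) (f : X -> term V Y) (t : term V X) :
  eval (fun x => cls (@satisfies V Y) (f x) : free_alg V Y) t
  = cls (@satisfies V Y) (subst f t).
Proof.
elim: t => //= o ts IH; apply/cls_satisfies => A hA v /=.
congr (ops A o _); apply: funext => i.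
have /cls_satisfies : cls (@satisfies V Y)
   (rep (eval (fun x => cls (@satisfies V Y) (f x) : free_alg V Y) (ts i)))
   = cls (@satisfies V Y) (subst f (ts i)) by rewrite clsK IH.
by apply.
Qed.

Lemma free_alg_in_variety (V : variety) (X : Type) : in_variety (free_alg V X).
Proof.
move=> e he v.
have -> : v = (fun n => cls (@satisfies V X) (rep (v n)) : free_alg V X).
  by apply: funext => n; rewrite clsK.
rewrite !eval_free; apply/cls_satisfies => A hA w.
by rewrite !eval_subst; apply: hA.
Qed.

Definition homomorphism (S : signature) (A B : algebra S) (h : A -> B) : Prop :=
  forall (o : S) (a : 'I_(arity o) -> A), h (ops A o a) = ops B o (h \o a).

Lemma free_alg_universal (V : variety) (X : Type) (A : algebra V) (v : X -> A) :
  in_variety A ->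
  exists! h : free_alg V X -> A,
    homomorphism h /\ forall x, h (gen V x) = v x.
Proof.
move=> hA.
have evr t : eval v (rep (cls (@satisfies V X) t)) = eval v t.
  by have /cls_satisfies := clsK (cls (@satisfies V X) t); apply.
exists (fun c : free_alg V X => eval v (rep c)); split; first split.
- by move=> o a; rewrite /= evr.
- by move=> x; rewrite evr.
move=> h [hh hg]; apply: funext => c; rewrite -{2}(clsK c).
elim: (rep c) => [x|o ts IH]; first by rewrite -/(gen V x) hg.
transitivity (h (ops (free_alg V X) o (fun i => cls (@satisfies V X) (ts i)))).
  by rewrite hh /=; congr (ops A o _); apply: funext => i /=; rewrite -IH.
congr h; apply/cls_satisfies => B hB w /=; congr (ops B o _).
apply: funext => i.
by have /cls_satisfies := clsK (cls (@satisfies V X) (ts i)); apply.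
Qed.

(* The n-ary part of the term clone of [V] is the free algebra on n generators;
   the composition of [f] with [g_0, ..., g_(n-1)] is the value at [f] of the
   homomorphism sending the i-th generator to [g_i]. *)
Definition clone (V : variety) (n : nat) : Type := free_alg V 'I_n.

Definition clone_proj (V : variety) (n : nat) (i : 'I_n) : clone V n := gen V i.

Definition clone_comp (V : variety) (n m : nat) (f : clone V n)
    (g : 'I_n -> clone V m) : clone V m :=
  @eval V (free_alg V 'I_m) 'I_n g (rep f).

Definition clone_homomorphism (V W : variety)
    (phi : forall n, clone V n -> clone W n) : Prop :=
  (forall n (i : 'I_n), phi n (clone_proj V i) = clone_proj W i) /\
  (forall n m (f : clone V n) (g : 'I_n -> clone V m),
     phi m (clone_comp f g) = clone_comp (phi n f) (fun i => phi m (g i))).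

Definition interprets_in (V W : variety) : Prop :=
  exists phi : forall n, clone V n -> clone W n, clone_homomorphism phi.

Definition idempotent_term (V : variety) (n : nat) (t : term V 'I_n) : Prop :=
  V |= subst (fun=> Var tt) t ≈ Var tt.

Definition idempotent_sig (V : variety) : signature :=
  @Signature {n : nat & {t : term V 'I_n | idempotent_term t}}
    (fun o => projT1 o).

Fixpoint expand (V : variety) (X : Type) (t : term (idempotent_sig V) X) :
    term V X :=
  match t with
  | Var x => Var x
  | App o ts => subst (fun i => expand (ts i)) (sval (projT2 o))
  end.

Definition full_idempotent_reduct (V : variety) : variety :=
  @Variety (idempotent_sig V) [set e | V |= expand e.1 ≈ expand e.2].

Definition semilattice_sig : signature := @Signature unit (fun=> 2).

Definition meet (X : Type) (s t : term semilattice_sig X) :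
    term semilattice_sig X :=
  @App semilattice_sig X tt (tnth [tuple s; t]).

Definition semilattices : variety :=
  let x := Var 0 in let y := Var 1 in let z := Var 2 in
  @Variety semilattice_sig
    [set (meet x x, x); (meet x y, meet y x);
         (meet x (meet y z), meet (meet x y) z)].

Definition Hobby_McKenzie (V : variety) : Prop :=
  ~ interprets_in (full_idempotent_reduct V) semilattices.

Record digraph : Type :=
  Digraph { vertex :> Type; edge : vertex -> vertex -> Prop }.

Definition reflexive_digraph (G : digraph) : Prop := forall a : G, edge a a.

Definition weak_equiv (G : digraph) : G -> set G :=
  clos_refl_trans G (fun a b => edge a b \/ edge b a).

Definition strong_equiv (G : digraph) : G -> set G :=
  fun a b => clos_refl_trans G (@edge G) a b /\ clos_refl_trans G (@edge G) b a.

Definition extreme_equiv (G : digraph) : G -> set G :=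
  clos_refl_trans G (fun a b => edge a b /\ edge b a).

Definition extremely_connected (G : digraph) : Prop :=
  exists c : quot (@extreme_equiv G), forall d, d = c.

Definition quot_digraph (G : digraph) (alpha : G -> set G) : digraph :=
  @Digraph (quot alpha)
    (fun A B => exists a b : G, [/\ sval A a, sval B b & edge a b]).

Fixpoint radical_step (G : digraph) (i : nat) : G -> set G :=
  match i with
  | 0 => @extreme_equiv G
  | j.+1 => fun a b =>
      @extreme_equiv (quot_digraph (@radical_step G j))
        (cls (@radical_step G j) a) (cls (@radical_step G j) b)
  end.

Definition radical_equiv (G : digraph) : G -> set G :=
  fun a b => exists i, radical_step i a b.

Definition induced (G : digraph) (A : set G) : digraph :=
  @Digraph {a : G | A a} (fun a b => edge (sval a) (sval b)).

Definition compatible (V : variety) (G : digraph) : Prop :=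
  exists f : operations V G,
    in_variety (Algebra f) /\
    @subuniverse V (square (Algebra f)) [set p | edge p.1 p.2].

Definition free_digraph (V : variety) (P : digraph) : digraph :=
  @Digraph (free_alg V P)
    (fun a b => smallest (@subuniverse V (square (free_alg V P)))
       [set p | exists x y : P, edge x y /\ p = (gen V x, gen V y)] (a, b)).

Definition cycle_digraph (n : nat) : digraph :=
  @Digraph 'I_n (fun i j => j = i \/ j = ordS i).

Definition cycle_component_extremely_connected (V : variety) (n : nat) : Prop :=
  exists C : quot (@weak_equiv (free_digraph V (cycle_digraph n))),
    (forall i : cycle_digraph n, sval C (gen V i)) /\
    extremely_connected (induced (sval C)).

Definition x3 (V : variety) : term V 'I_3 := Var (@Ordinal 3 0 isT).
Definition y3 (V : variety) : term V 'I_3 := Var (@Ordinal 3 1 isT).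
Definition z3 (V : variety) : term V 'I_3 := Var (@Ordinal 3 2 isT).

Definition app6 (V : variety) (t : term V 'I_6) (a b c d e f : term V 'I_3) :
    term V 'I_3 :=
  subst (tnth [tuple a; b; c; d; e; f]) t.

(* Main.v *)
(* The main implication is from the Hobby-McKenzie property to the equality of
   the strong and the extreme equivalence. Consider, for every idempotent term t,
   a set phi(t) of variables of t such that phi(t) included in J implies phi(t)
   included in K whenever V satisfies t(x on J, y off J) = t(x on K, y off K). If
   all phi(t) can be chosen nonempty, a minimal choice compatible with renaming of
   variables is compatible with substitution, hence interprets the idempotent
   reduct in semilattices, phi(t) being the variables of the image of t.
   Otherwise some idempotent t has, for every nonempty S, an identity as above
   with S included in J but not in K.

   Call a set S of variables decisive if t(c_1, ..., c_m) lies in the extreme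
   class B of c_0 whenever the c_i are vertices of a given closed walk through c_0
   and c_i = c_0 for i in S. The identity for S turns a decisive S into the smaller
   decisive set S inter K, so the empty set is decisive and the walk stays in B.
   The steps use that B is convex: x -> y -> z and x, z in B imply y in B. When x
   and z are joined by a double edge this is again an induction on sets S; the
   general case follows by composing the edge relation with its symmetric part,
   which halves the distance from x to z.

   If conversely the idempotent reduct has a semilattice interpretation, the
   supports of terms show that in the digraph freely generated by P a generator
   without double edges in P is extremely equivalent to no other generator. This
   refutes the identities, and the equality of radical and extreme equivalence
   in the free digraph of a suitable P. The identities themselves spell out a
   path of double edges between two generators of the free digraph of C_3. *)

Require Import Defs.
From mathcomp Require Import all_boot.
From mathcomp Require Import boolp classical_sets.
From mathcomp Require Import fintype finset.
From Stdlib Require Import Relations.Relation_Operators.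

Set Implicit Arguments.
Unset Strict Implicit.
Unset Printing Implicit Defensive.

(** * Strong and extreme equivalence in the presence of the term *)

Section RelationPowers.
Variable G : Type.
Implicit Types R S : G -> G -> Prop.

Definition relcomp R S : G -> G -> Prop := fun a c => exists2 b, R a b & S b c.

Fixpoint relpow R n : G -> G -> Prop :=
  if n is m.+1 then relcomp R (relpow R m) else eq.

Definition sympart R : G -> G -> Prop := fun a b => R a b /\ R b a.

Lemma clos_relpow R a b : clos_refl_trans G R a b <-> exists n, relpow R n a b.
Proof.
split=> [|[n]].
  have powD n m x y z : relpow R n x y -> relpow R m y z -> relpow R (n + m) x z.
    elim: n x => [x ->//|n IH x /= [w xw wy] yz]; exists w => //; exact: IH.
  elim=> [x y xy|x|x y z _ [n xy] _ [m yz]].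
  - by exists 1; exists y.
  - by exists 0.
  - by exists (n + m); apply: powD xy yz.
elim: n a => [a ->|n IH a /= [c ac cb]]; first exact: rt_refl.
by apply: (rt_trans _ _ _ c); [apply: rt_step|apply: IH].
Qed.

Lemma relpow_mono R n m a b : (forall x, R x x) -> n <= m -> relpow R n a b -> relpow R m a b.
Proof.
move=> Rxx; elim: m n a => [|m IH] [|n] a //= nm.
  by move=> ->; exists b => //; apply: (IH 0).
by case=> c ac cb; exists c => //; apply: (IH n).
Qed.

Lemma relpow_sub R S n a b : (forall x y, R x y -> S x y) -> relpow R n a b -> relpow S n a b.
Proof.
by move=> RS; elim: n a => [//|n IH] a /= [c /RS ac /IH cb]; exists c.
Qed.

Lemma relpow_comp2 R n a b : relpow R n.*2 a b -> relpow (relcomp R R) n a b.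
Proof.
elim: n a => [//|n IH] a; rewrite doubleS /= => -[c ac [d cd db]].
by exists d; [exists c|apply: IH].
Qed.

Lemma relpow_path R n a b : relpow R n a b ->
  exists c : nat -> G, [/\ c 0 = a, c n = b & forall i, i < n -> R (c i) (c i.+1)].
Proof.
elim: n a => [a <-|n IH a /= [d ad /IH[c [c0 cn Rc]]]]; first by exists (fun=> a).
exists (fun i => if i is j.+1 then c j else a); split=> // -[|i] //= ?.
  by rewrite c0.
exact: Rc.
Qed.

Variables (X : Type) (F : (X -> G) -> G).

Definition preserves R : Prop :=
  forall u v : X -> G, (forall i, R (u i) (v i)) -> R (F u) (F v).

Lemma preserves_eq : preserves eq.
Proof. by move=> u v uv; congr F; apply: funext. Qed.

Lemma preserves_relcomp R S : preserves R -> preserves S -> preserves (relcomp R S).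
Proof.
move=> pR pS u v uv; have [w uw wv] : exists2 w : X -> G,
    forall i, R (u i) (w i) & forall i, S (w i) (v i).
  have h i : exists b, R (u i) b /\ S b (v i) by case: (uv i) => b; exists b.
  by have [w hw] := choice h; exists w => i; case: (hw i).
by exists (F w); [apply: pR|apply: pS].
Qed.

Lemma preserves_sympart R : preserves R -> preserves (sympart R).
Proof. by move=> pR u v uv; split; apply: pR => i; case: (uv i). Qed.

Lemma preserves_and R S :
  preserves R -> preserves S -> preserves (fun a b => R a b /\ S a b).
Proof.
by move=> pR pS u v uv; split; [apply: pR|apply: pS] => i; case: (uv i).
Qed.

Lemma preserves_relpow R n : preserves R -> preserves (relpow R n).
Proof.
move=> pR; elim: n => [|n IH]; first exact: preserves_eq.
exact: preserves_relcomp.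
Qed.

End RelationPowers.

Section FiniteArity.
Variables (G : Type) (X : finType) (F : (X -> G) -> G).

Lemma preserves_clos R : (forall x, R x x) -> preserves F R ->
  preserves F (clos_refl_trans G R).
Proof.
move=> Rxx pR u v uv.
have h i : exists n, relpow R n (u i) (v i) by apply/clos_relpow.
have [n hn] := choice h.
apply/clos_relpow; exists (\max_i n i); apply: preserves_relpow => // i.
by apply: relpow_mono (hn i) => //; apply: leq_bigmax.
Qed.

Hypothesis F_idem : forall x, F (fun=> x) = x.

Definition mix (J : {set X}) (x y : G) : X -> G := fun i => if i \in J then x else y.

Hypothesis F_star : forall S : {set X}, S != set0 ->
  exists J K : {set X}, [/\ S \subset J, ~~ (S \subset K)
    & forall x y, F (mix J x y) = F (mix K x y)].

Definition ext (E : G -> G -> Prop) := clos_refl_trans G (sympart E).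

Lemma ext_sym E a b : ext E a b -> ext E b a.
Proof.
elim=> [x y [xy yx]|x|x y z _ yx _ zy]; first by apply: rt_step.
  exact: rt_refl.
exact: rt_trans zy yx.
Qed.

Lemma preserves_ext E : (forall x, E x x) -> preserves F E -> preserves F (ext E).
Proof.
by move=> Exx pE; apply: preserves_clos => [x|]; [split|apply: preserves_sympart].
Qed.

Section Core.
Variables (E Th : G -> G -> Prop).
Hypotheses (E_refl : forall x, E x x) (E_pres : preserves F E).
Hypotheses (Th_refl : forall x, Th x x) (Th_pres : preserves F Th).
Let rho := ext E.
Hypothesis sandwich : forall x w y, Th x y -> E x w -> E w y -> rho w x.
Variables a1 a2 g1 g2 b : G.
Hypotheses (Tha : Th a1 a2) (Thg : Th g1 g2).
Hypotheses (ra2 : rho a2 a1) (rg1 : rho g1 a1) (rg2 : rho g2 a1).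
Hypotheses (a1b : E a1 b) (bg2 : E b g2) (g2a2 : E g2 a2) (g1a1 : E g1 a1).
Hypotheses (a1a2 : E a1 a2) (g1a2 : E g1 a2) (g1g2 : E g1 g2).

Let Phi (Z : {set X}) := F (mix Z b a1).
Let irrelevant_off (S : {set X}) :=
  forall Z Z' : {set X}, Z :&: S = Z' :&: S -> rho (Phi Z) (Phi Z').

Let rho_pres : preserves F rho. Proof. exact: preserves_ext. Qed.
Let rho_refl x : rho x x. Proof. exact: rt_refl. Qed.
Let rho_trans y x z : rho x y -> rho y z -> rho x z.
Proof. exact: rt_trans. Qed.
Let rho_sym x y : rho x y -> rho y x. Proof. exact: ext_sym. Qed.

Let cosingleton (S J K : {set X}) c :
  irrelevant_off S -> S \subset J -> c \in S -> c \notin K ->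
  (forall x y, F (mix J x y) = F (mix K x y)) -> rho (Phi (~: [set c])) b.
Proof.
move=> irr SJ cS cK FJK.
pose w i := if i == c then a1 else if i \in J then b else
            if i \in K then g2 else a2.
have cJ : c \in J by apply: (subsetP SJ).
have wf : rho (F w) (Phi J).
  rewrite /Phi FJK; apply: (sandwich (y := F (mix J b a2))).
  - by rewrite -FJK; apply: Th_pres => i; rewrite /mix; case: ifP.
  - apply: E_pres => i; rewrite /mix /w; have [->|_] := eqVneq i c.
      by rewrite (negPf cK).
    by case: (i \in J); case: (i \in K).
  - apply: E_pres => i; rewrite /mix /w; have [->|_] := eqVneq i c; first by rewrite cJ.
    by case: (i \in J) => //; case: (i \in K).
have fb : rho (Phi J) b.
  rewrite -[X in rho _ X]F_idem -[X in F X](_ : mix setT b a1 = _).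
    by apply: irr; rewrite setTI; apply/setIidPr.
  by apply: funext => i; rewrite /mix inE.
apply: rho_trans fb; apply: rho_trans wf.
apply: (rho_trans (y := Phi (J :\ c))).
  apply: irr; apply/setP => i; rewrite !inE.
  by case iS: (i \in S); rewrite ?andbF // (subsetP SJ) ?iS // !andbT.
apply: rho_pres => i; rewrite /mix /w !inE.
case: eqP => //= _; case: ifP => // _.
by case: ifP => _; apply: rho_sym.
Qed.

(* Both [s1] and [s2] evaluate the matrix idempotent-wise: [F s1] is the value of
   [F (F _)] at the matrix with constant columns [s1 j], and [F s2] is its value at
   the matrix with constant rows [s2 i]; [M] lies between the two. *)
Let irrelevant_at c Z : rho (Phi (~: [set c])) b ->
  rho (Phi Z) (Phi (c |: Z)).
Proof.
move=> Hc; case cZ: (c \in Z).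
  by rewrite (_ : c |: Z = Z) //; apply/setUidPr; rewrite sub1set.
pose s1 i := if i == c then g1 else if i \in Z then b else a1.
pose s2 i := if i == c then g2 else if i \in Z then b else a2.
pose M i j := if i == c then (if j == c then g2 else b) else
              if i \in Z then (if j == c then a1 else b) else
              if j == c then a2 else if j \in Z then g2 else a2.
have Ms1 : rho (F (fun i => F (M i))) (F s1).
  apply: (sandwich (y := F s2)).
  - by apply: Th_pres => i; rewrite /s1 /s2; do 2 case: ifP => // _.
  - rewrite -[X in E X _]F_idem; apply: E_pres => i; apply: E_pres => j.
    rewrite /s1 /M; case: (i == c); case: (j == c) => //;
      by case: (i \in Z); case: (j \in Z).
  - apply: E_pres => i; rewrite -[X in E _ X]F_idem; apply: E_pres => j.
    rewrite /s2 /M; case: (i == c); case: (j == c) => //;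
      by case: (i \in Z); case: (j \in Z).
apply: (rho_trans (y := F s1)).
  apply: rho_pres => i; rewrite /mix /s1; case: eqP => [->|_]; last exact: rho_refl.
  by rewrite cZ; apply: rho_sym.
apply: (rho_trans (rho_sym Ms1)); apply: rho_pres => i.
rewrite /mix !inE /M; have [_|_] /= := eqVneq i c.
  apply: rho_trans Hc; apply: rho_pres => j; rewrite /mix !inE.
  by case: eqP.
case: ifP => _.
  apply: rho_trans Hc; apply: rho_pres => j; rewrite /mix !inE.
  by case: eqP => _; apply: rho_refl.
rewrite -[X in rho _ X]F_idem; apply: rho_pres => j.
by case: eqP => // _; case: ifP.
Qed.

Lemma core : rho b a1.
Proof.
suff irr0 : irrelevant_off set0.
  rewrite -[b]F_idem -[a1]F_idem.
  rewrite -[X in rho (F X) _](_ : mix setT b a1 = _); last first.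
    by apply: funext => i; rewrite /mix inE.
  rewrite -[X in rho _ (F X)](_ : mix set0 b a1 = _); last first.
    by apply: funext => i; rewrite /mix inE.
  by apply: irr0; rewrite !setI0.
suff irrn n (S : {set X}) : #|S| <= n -> irrelevant_off S -> irrelevant_off set0.
  by apply: (irrn _ setT (leqnn _)) => Z Z'; rewrite !setIT => ->.
elim: n S => [|n IH] S; first by rewrite leqn0 cards_eq0 => /eqP ->.
move=> cardS irr; have [S0|S0] := eqVneq S set0; first by rewrite -S0.
have [J [K [SJ /subsetPn[c cS cK] FJK]]] := F_star S0.
have Hc := cosingleton irr SJ cS cK FJK.
apply: (IH (S :\ c)); first by move: cardS; rewrite (cardsD1 c S) cS.
move=> Z Z' ZZ'.
apply: rho_trans (irrelevant_at Z Hc) _; apply: rho_trans (rho_sym (irrelevant_at Z' Hc)).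
apply: irr; apply/setP => i; move/setP/(_ i): ZZ'; rewrite !inE.
by case: eqP => [->|_] //=.
Qed.

End Core.

Section Digraph.
Variable E : G -> G -> Prop.
Hypotheses (E_refl : forall x, E x x) (E_pres : preserves F E).

Lemma sandwich1 p b p' : sympart E p p' -> E p b -> E b p' -> ext E b p.
Proof.
move=> [pp' p'p] pb bp'.
have rp : ext E p' p by apply: rt_step.
apply: (core E_refl E_pres _ (@preserves_eq _ _ F) _ (erefl p) (erefl p') (rt_refl _ _ p)
          rp rp pb bp') => //.
by move=> x w _ <- xw wx; apply: rt_step.
Qed.

Lemma sandwich2 p e b p' : sympart E p e -> sympart E e p' -> E p b -> E b p' ->
  ext E b p.
Proof.
move=> pe ep' pb bp'.
have re : ext E e p by apply: rt_step; case: pe.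
have rp : ext E p' p by apply: rt_trans re; apply: rt_step; case: ep'.
have [[p_e e_p] [e_p' p'_e]] := (pe, ep').
apply: (core E_refl E_pres _ (preserves_sympart E_pres) _ pe ep' re re rp pb bp') => //.
by move=> x w y xy xw wy; apply: sandwich1 xy xw wy.
Qed.

Definition thicken : G -> G -> Prop := fun a b =>
  relcomp E (sympart E) a b /\ relcomp (sympart E) E a b.

Lemma thicken_sub a b : E a b -> thicken a b.
Proof. by move=> ab; split; [exists b|exists a]. Qed.

Lemma thicken_pres : preserves F thicken.
Proof. by apply: preserves_and; apply: preserves_relcomp => //; apply: preserves_sympart. Qed.

Lemma thicken_sympart a b : relcomp (sympart E) (sympart E) a b -> sympart thicken a b.
Proof.
case=> e [ae ea] [eb be].
by split; split; exists e.
Qed.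

End Digraph.

Lemma ext_thicken E a b : (forall x, E x x) -> preserves F E ->
  ext (thicken E) a b -> ext E a b.
Proof.
move=> E_refl E_pres; elim=> [x y [[[z xz [zy yz]] _] [_ [v [yv vy] vx]]]|x|x y z _ xy _ yz].
- have xv : ext E x v by apply: (@sandwich2 E E_refl E_pres v y x z).
  by apply: rt_trans xv _; apply: rt_step.
- exact: rt_refl.
- exact: rt_trans xy yz.
Qed.

Lemma sandwich_relpow E n p b p' : (forall x, E x x) -> preserves F E ->
  relpow (sympart E) (2 ^ n) p p' -> E p b -> E b p' -> ext E b p.
Proof.
elim: n E => [|n IH] E E_refl E_pres; first by case=> q pq <-; apply: sandwich1.
rewrite expnSr muln2 => pp' pb bp'.
have {}pp' := relpow_sub (@thicken_sympart E) (relpow_comp2 pp').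
apply: (ext_thicken E_refl E_pres); apply: IH pp' _ _.
- by move=> x; apply: thicken_sub.
- exact: thicken_pres.
- exact: thicken_sub.
- exact: thicken_sub.
Qed.

Section Strong.
Variable E : G -> G -> Prop.
Hypotheses (E_refl : forall x, E x x) (E_pres : preserves F E).

Lemma ext_convex x y z w : ext E w x -> ext E w z -> E x y -> E y z -> ext E w y.
Proof.
move=> wx wz xy yz; apply: (rt_trans _ _ _ x) => //; apply: ext_sym.
have /clos_relpow[n xz] : ext E x z by apply: rt_trans wz; apply: ext_sym.
apply: sandwich_relpow xy yz => //; apply: (relpow_mono (n := n)) xz.
  by move=> ?; split.
exact/ltnW/ltn_expl.
Qed.

Section ClosedWalk.
Variables (n : nat) (c : nat -> G).
Hypotheses (c_step : forall i, i < n -> E (c i) (c i.+1)) (c_closed : c n = c 0).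

Let B x := ext E (c 0) x.

Let word (u : X -> nat) : G := F (c \o u).

Let decisive (S : {set X}) := forall u : X -> nat, (forall i, u i <= n) ->
  (forall i, i \in S -> c (u i) = c 0) -> B (word u).

Let convex u v w : (forall i, E (c (u i)) (c (v i))) -> (forall i, E (c (v i)) (c (w i))) ->
  B (word u) -> B (word w) -> B (word v).
Proof. by move=> uv vw Bu Bw; apply: ext_convex Bu Bw _ _; apply: E_pres. Qed.

Let decisive_const (S J K : {set X}) : decisive S -> S \subset J ->
  (forall x y, F (mix J x y) = F (mix K x y)) -> decisive K.
Proof.
move=> dS SJ FJK u un uK.
suff arc d i : i + d <= n -> forall v, (forall l, l \in K -> c (v l) = c 0) ->
    (forall l, l \notin K -> i <= v l <= i + d) -> B (word v).
  by apply: (arc n 0) => // l _; rewrite un.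
elim: d i => [|d IH] i idn v vK v_i.
  rewrite /word (_ : c \o v = mix K (c 0) (c i)).
    rewrite -FJK (_ : mix J _ _ = c \o (fun l => if l \in J then 0 else i)).
      apply: dS => l; first by case: ifP => //; rewrite -(addn0 i).
      by move=> /(subsetP SJ) ->.
    by apply: funext => l; rewrite /mix /=; case: ifP.
  apply: funext => l; rewrite /mix /=; case: ifPn => [/vK //|/v_i].
  by rewrite addn0 -eqn_leq => /eqP ->.
have lt_n j : j < n -> E (c j) (c j.+1) by exact: c_step.
apply: (@convex (fun l => if l \in K then v l else minn (v l) (i + d)) v
                (fun l => if l \in K then v l else maxn (v l) i.+1)).
- move=> l; case: ifPn => // /v_i /andP[_]; rewrite addnS leq_eqVlt ltnS => /predU1P[->|le].
    by rewrite (minn_idPr (leqnSn _)); apply: lt_n; rewrite -addnS.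
  by rewrite (minn_idPl le).
- move=> l; case: ifPn => // /v_i /andP[]; rewrite leq_eqVlt => /predU1P[<- _|lt _].
    rewrite (maxn_idPr (leqnSn _)); apply: lt_n; apply: leq_trans idn.
    by rewrite addnS ltnS leq_addr.
  by rewrite (maxn_idPl lt).
- apply: (IH i); first by apply: leq_trans idn; rewrite leq_add2l.
    by move=> l lK; rewrite lK; apply: vK.
  move=> l lK; rewrite (negPf lK) leq_min geq_minr leq_addr andbT.
  by case/andP: (v_i l lK) => ->.
- apply: (IH i.+1); first by rewrite addSnnS.
    by move=> l lK; rewrite lK; apply: vK.
  move=> l lK; rewrite (negPf lK) leq_maxr geq_max leq_addr andbT.
  by case/andP: (v_i l lK) => _; rewrite addSnnS.
Qed.

Let decisive_setI (S K : {set X}) : decisive S -> decisive K -> decisive (S :&: K).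
Proof.
move=> dS dK u un uSK.
suff hk h k : forall v, (forall i, v i <= n) ->
    (forall i, i \in S :&: K -> c (v i) = c 0) ->
    (forall i, i \in S :\: K -> v i <= h) ->
    (forall i, i \in K :\: S -> n <= v i + k) -> B (word v).
  by apply: (hk n n) => // i _; rewrite leq_addl.
elim: h k => [|h IHh] k v vn vSK vS vK.
  apply: dS => // i iS; case iK: (i \in K); first by apply: vSK; rewrite inE iS.
  by have := vS i; rewrite inE iS iK leqn0 => /(_ isT)/eqP ->.
elim: k v vn vSK vS vK => [|k IHk] v vn vSK vS vK.
  apply: dK => // i iK; case iS: (i \in S); first by apply: vSK; rewrite inE iS.
  have := vK i; rewrite inE iS iK addn0 => /(_ isT) nv.
  by rewrite -c_closed; congr c; apply/eqP; rewrite eqn_leq vn.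
apply: (@convex (fun i => if i \in S :\: K then minn (v i) h else v i) v
                (fun i => if i \in K :\: S then minn (v i).+1 n else v i)).
- move=> i; case: ifPn => // /vS; rewrite leq_eqVlt ltnS => /predU1P[vh|le].
    by rewrite vh (minn_idPr (leqnSn _)); apply: c_step; rewrite -vh.
  by rewrite (minn_idPl le).
- move=> i; case: ifPn => // _; have := vn i; rewrite leq_eqVlt => /predU1P[->|lt].
    by rewrite (minn_idPr (leqnSn _)).
  by rewrite (minn_idPl lt); apply: c_step.
- apply: (IHh k.+1).
  + by move=> i; case: ifP => // _; rewrite geq_min vn.
  + move=> i iSK; rewrite ifN; first exact: vSK.
    by move: iSK; rewrite !inE => /andP[_ ->].
  + by move=> i iS; rewrite iS geq_minr.
  + move=> i iK; rewrite ifN; first exact: vK.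
    by move: iK; rewrite !inE => /andP[_ ->].
- apply: IHk.
  + by move=> i; case: ifP => // _; rewrite geq_minr.
  + move=> i iSK; rewrite ifN; first exact: vSK.
    by move: iSK; rewrite !inE => /andP[->].
  + move=> i iS; rewrite ifN; first exact: vS.
    by move: iS; rewrite !inE => /andP[_ ->].
  + move=> i iK; rewrite iK; have [le|_] := leqP n (v i).+1; last first.
      by rewrite addSnnS; apply: vK.
    exact: leq_addr.
Qed.

Lemma closed_walk_ext i : i <= n -> ext E (c 0) (c i).
Proof.
move=> le_in.
suff d0 : decisive set0.
  rewrite -[c i]F_idem; apply: (d0 (fun=> i)) => // j; by rewrite inE.
suff dn m (S : {set X}) : #|S| <= m -> decisive S -> decisive set0.
  apply: (dn _ setT (leqnn _)) => u _ uT; rewrite /word.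
  rewrite (_ : c \o u = fun=> c 0) ?F_idem; first exact: rt_refl.
  by apply: funext => j /=; rewrite uT.
elim: m S => [|m IH] S; first by rewrite leqn0 cards_eq0 => /eqP ->.
move=> cardS dS; have [S0|S0] := eqVneq S set0; first by rewrite -S0.
have [J [K [SJ SK FJK]]] := F_star S0.
apply: (IH (S :&: K)); last exact: decisive_setI dS (decisive_const dS SJ FJK).
rewrite -ltnS; apply: leq_trans cardS; apply: proper_card.
by rewrite properE subsetIl subsetI subxx.
Qed.

End ClosedWalk.

Lemma strong_ext a b : clos_refl_trans G E a b -> clos_refl_trans G E b a -> ext E a b.
Proof.
move=> /clos_relpow[n ab] /clos_relpow[m ba].
have [c [c0 cn cs]] := relpow_path ab.
have [d [d0 dm ds]] := relpow_path ba.
pose e i := if i <= n then c i else d (i - n).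
have en i : e (n + i) = d i.
  rewrite /e addKn; case: i => [|i]; first by rewrite addn0 leqnn d0.
  by rewrite ifN // -ltnNge addnS ltnS leq_addr.
have e0 : e 0 = a by rewrite /e leq0n c0.
have e_n : e n = b by rewrite -[n]addn0 en d0.
have walk i : i < n + m -> E (e i) (e i.+1).
  move=> ilt; have [lt|le] := ltnP i n; first by rewrite /e lt ltnW //; apply: cs.
  by rewrite -(subnKC le) -addnS !en; apply: ds; rewrite ltn_subLR.
rewrite -e0 -e_n; apply: (closed_walk_ext walk _ (leq_addr _ _)).
by rewrite en dm e0.
Qed.

End Strong.
End FiniteArity.

(** * Idempotent terms and systems of supports *)

Section Terms.
Variable V : variety.

Definition rename (X Y : Type) (p : X -> Y) (t : term V X) : term V Y :=
  subst (fun x => Var (p x)) t.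

Definition idem (X : Type) (t : term V X) : Prop :=
  V |= rename (fun=> tt) t ≈ Var tt.

Definition star (X Y : Type) (f : term V X) (t : term V Y) : term V (X * Y) :=
  subst (fun x => rename (pair x) t) f.

Lemma eval_rename (A : algebra V) (X Y : Type) (p : X -> Y) (v : Y -> A) (t : term V X) :
  eval v (rename p t) = eval (v \o p) t.
Proof. by rewrite /rename eval_subst. Qed.

Lemma eval_star (A : algebra V) (X Y : Type) (v : X * Y -> A) (f : term V X) (t : term V Y) :
  eval v (star f t) = eval (fun x => eval (fun y => v (x, y)) t) f.
Proof.
by rewrite /star eval_subst; congr (eval _ f); apply: funext => x; rewrite eval_rename.
Qed.

Lemma eval_idem (A : algebra V) (X : Type) (t : term V X) (a : A) :
  in_variety A -> idem t -> eval (fun=> a) t = a.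
Proof. by move=> hA /(_ A hA (fun=> a)); rewrite eval_rename. Qed.

Lemma idem_rename (X Y : Type) (p : X -> Y) (t : term V X) : idem t -> idem (rename p t).
Proof. by move=> it A hA v; rewrite !eval_rename /=; apply: eval_idem. Qed.

Lemma idem_subst (X Y : Type) (g : X -> term V Y) (f : term V X) :
  idem f -> (forall x, idem (g x)) -> idem (subst g f).
Proof.
move=> hf hg A hA v; rewrite eval_rename eval_subst /= -[RHS](eval_idem _ hA hf).
by congr (eval _ f); apply: funext => x; apply: eval_idem.
Qed.

Lemma idem_star (X Y : Type) (f : term V X) (t : term V Y) :
  idem f -> idem t -> idem (star f t).
Proof. by move=> hf ht; apply: idem_subst => // x; apply: idem_rename. Qed.

Lemma satisfies_sym (X : Type) (s t : term V X) : V |= s ≈ t -> V |= t ≈ s.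
Proof. by move=> st A hA v; rewrite (st A hA). Qed.

Lemma satisfies_trans (X : Type) (t s u : term V X) :
  V |= s ≈ t -> V |= t ≈ u -> V |= s ≈ u.
Proof. by move=> st tu A hA v; rewrite (st A hA) (tu A hA). Qed.

Lemma idem_satisfies (X : Type) (s t : term V X) : V |= s ≈ t -> idem s -> idem t.
Proof.
by move=> st hs A hA v; rewrite eval_rename -(st A hA) -(hs A hA) eval_rename.
Qed.

Lemma rename_fst_star (X Y : Type) (f : term V X) (t : term V Y) :
  idem t -> V |= rename fst (star f t) ≈ f.
Proof.
move=> ht A hA v; rewrite eval_rename eval_star /=.
by congr (eval _ f); apply: funext => x; rewrite (eval_idem _ hA ht).
Qed.

Lemma rename_snd_star (X Y : Type) (f : term V X) (t : term V Y) :
  idem f -> V |= rename snd (star f t) ≈ t.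
Proof. by move=> hf A hA v; rewrite eval_rename eval_star /= (eval_idem _ hA hf). Qed.

Lemma rename_star (X Y Z : Type) (p : Y -> Z) (f : term V X) (t : term V Y) :
  V |= rename (fun xy => (xy.1, p xy.2)) (star f t) ≈ star f (rename p t).
Proof.
move=> A hA v; rewrite eval_rename !eval_star /=.
by congr (eval _ f); apply: funext => x; rewrite eval_rename.
Qed.

Lemma rename_star_l (X Y Z : Type) (p : X -> Z) (f : term V X) (t : term V Y) :
  V |= rename (fun xy => (p xy.1, xy.2)) (star f t) ≈ star (rename p f) t.
Proof. by move=> A hA v; rewrite eval_rename !eval_star eval_rename. Qed.

Lemma satisfies_star_r (X Y : Type) (f : term V X) (s t : term V Y) :
  V |= s ≈ t -> V |= star f s ≈ star f t.
Proof.
move=> st A hA v; rewrite !eval_star; congr (eval _ f).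
by apply: funext => x; apply: st.
Qed.

Lemma satisfies_star_l (X Y : Type) (f g : term V X) (t : term V Y) :
  V |= f ≈ g -> V |= star f t ≈ star g t.
Proof. by move=> fg A hA v; rewrite !eval_star; apply: fg. Qed.

(* [V] satisfies [t(x on J, y off J) = t(x on K, y off K)]. *)
Definition identified (X : finType) (t : term V X) (J K : {set X}) : Prop :=
  V |= rename (fun x => x \in J) t ≈ rename (fun x => x \in K) t.

Definition good (X : finType) (t : term V X) (S : {set X}) : Prop :=
  forall J K, identified t J K -> S \subset J -> S \subset K.

Lemma good_satisfies (X : finType) (s t : term V X) S : V |= s ≈ t -> good s S -> good t S.
Proof.
move=> st gS J K JK; apply: gS => A hA v; have := JK A hA v.
by rewrite !eval_rename !(st A hA).
Qed.

Lemma good_image (X Y : finType) (p : X -> Y) (t : term V X) S :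
  good t S -> good (rename p t) (p @: S).
Proof.
move=> gS J K JK; rewrite !sub_imset_pre; apply: gS => A hA v.
have := JK A hA v; rewrite !eval_rename.
rewrite (_ : (v \o _) \o p = v \o (fun x => x \in p @^-1: J)); last first.
  by apply: funext => x; rewrite /= inE.
by move=> ->; congr (eval _ t); apply: funext => x; rewrite /= inE.
Qed.

Lemma good_imset_eq (X Y : finType) (p q : X -> Y) (t : term V X) S :
  V |= rename p t ≈ rename q t -> good t S -> p @: S = q @: S.
Proof.
move=> pq gS.
have sub (p' q' : X -> Y) : V |= rename p' t ≈ rename q' t -> q' @: S \subset p' @: S.
  move=> pq'; rewrite sub_imset_pre.
  apply: (gS (p' @^-1: (p' @: S))); last by rewrite -sub_imset_pre.
  move=> A hA v; have := pq' A hA (fun y => v (y \in p' @: S)); rewrite !eval_rename.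
  rewrite (_ : v \o _ = (fun y => v (y \in p' @: S)) \o p'); last first.
    by apply: funext => x; rewrite /= inE.
  by move=> ->; congr (eval _ t); apply: funext => x; rewrite /= inE.
apply/eqP; rewrite eqEsubset (sub _ _ pq) andbT; apply: sub; exact: satisfies_sym.
Qed.

Definition largest_good (X : finType) (t : term V X) : {set X} :=
  [set x | `[< exists S, good t S /\ x \in S >]].

Lemma largest_goodP (X : finType) (t : term V X) : good t (largest_good t).
Proof.
move=> J K JK sJ; apply/subsetP => x; rewrite inE => /asboolP[S [gS xS]].
apply: (subsetP (gS J K JK _)) xS; apply/subsetP => y yS; apply: (subsetP sJ).
by rewrite inE; apply/asboolP; exists S.
Qed.

Lemma good_sub_largest (X : finType) (t : term V X) S : good t S -> S \subset largest_good t.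
Proof. by move=> gS; apply/subsetP => x xS; rewrite inE; apply/asboolP; exists S. Qed.

Record system (phi : forall X : finType, term V X -> {set X}) : Prop := System {
  system_neq0 : forall X t, idem t -> phi X t != set0;
  system_good : forall X t, idem t -> good t (phi X t);
  system_lax : forall (X Y : finType) (p : X -> Y) t, idem t ->
    p @: phi X t \subset phi Y (rename p t);
  system_sat : forall X s t, idem s -> V |= s ≈ t -> phi X s = phi X t
}.

Definition minimal (phi : forall X : finType, term V X -> {set X}) : Prop :=
  system phi /\ forall psi : forall X : finType, term V X -> {set X}, system psi ->
    (forall X t, idem t -> psi X t \subset phi X t) ->
    forall X t, idem t -> phi X t \subset psi X t.

Lemma system_eq (phi psi : forall X : finType, term V X -> {set X}) :
  (forall X t, idem t -> phi X t = psi X t) -> system phi -> system psi.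
Proof.
move=> e [ne0 gd lax st]; split=> [X t ht|X t ht|X Y p t ht|X s t hs s_t].
- by rewrite -e //; apply: ne0.
- by rewrite -e //; apply: gd.
- by rewrite -!e //; [apply: lax|apply: idem_rename].
- by rewrite -!e //; [apply: st|apply: idem_satisfies hs].
Qed.

Lemma system_largest :
  (forall (X : finType) (t : term V X), idem t -> largest_good t != set0) ->
  system largest_good.
Proof.
move=> ne0; split=> [//|X t _|X Y p t _|X s t _ st].
- exact: largest_goodP.
- by apply: good_sub_largest; apply: good_image; apply: largest_goodP.
- apply/eqP; rewrite eqEsubset; apply/andP; split; apply: good_sub_largest.
    by apply: good_satisfies st _; apply: largest_goodP.
  by apply: good_satisfies (satisfies_sym st) _; apply: largest_goodP.
Qed.

(* The collection of all systems is too large for Zorn's lemma, but a system is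
   determined by its values at the terms over ordinals. *)
Definition extend (phi : forall n, term V 'I_n -> {set 'I_n}) (X : finType)
    (t : term V X) : {set X} :=
  enum_rank @^-1: phi #|X| (rename enum_rank t).

Lemma extend_restrict phi : system phi -> forall X t, idem t ->
  phi X t = extend (fun n => phi 'I_n) t.
Proof.
move=> [_ _ lax st] X t ht; apply/setP => x; rewrite inE; apply/idP/idP => xt.
  by apply: (subsetP (lax X 'I_#|X| enum_rank t ht)); apply/imsetP; exists x.
have := subsetP (lax 'I_#|X| X enum_val _ (idem_rename enum_rank ht)) x.
rewrite -(st X t); [|exact: ht|].
  by apply; apply/imsetP; exists (enum_rank x); rewrite ?enum_rankK.
move=> A hA v; rewrite !eval_rename; congr (eval _ t).
by apply: funext => y /=; rewrite enum_rankK.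
Qed.

Lemma minimal_system :
  (forall (X : finType) (t : term V X), idem t -> largest_good t != set0) ->
  exists phi, minimal phi.
Proof.
move=> /system_largest sys0.
have sysE phi : system phi -> system (extend (fun n => phi 'I_n)).
  by move=> sphi; apply: (system_eq (extend_restrict sphi) sphi).
pose T := {phi : forall n, term V 'I_n -> {set 'I_n} | system (extend phi)}.
pose mk phi (sphi : system phi) : T := exist _ (fun n => phi 'I_n) (sysE phi sphi).
pose R (s t : T) :=
  `[< forall (X : finType) (u : term V X),
        idem u -> extend (sval t) u \subset extend (sval s) u >].
have Rrefl s : R s s by apply/asboolP.
have Rtrans r s t : R r s -> R s t -> R r t.
  move=> /asboolP rs /asboolP st; apply/asboolP => X u hu.
  by apply: subset_trans (st X u hu) (rs X u hu).
have [|[phi sphi] phimax] := ZL_preorder (mk _ sys0) Rrefl Rtrans; last first.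
  exists (extend phi); split=> // psi spsi le X t ht.
  rewrite (extend_restrict spsi) //.
  apply: (asboolP _ (phimax (mk _ spsi) _)) => //; apply/asboolP => Y u hu /=.
  by rewrite -extend_restrict //; apply: le.
move=> A Atot; have [[s0 As0]|noA] := pselect (exists s, A s); last first.
  by exists (mk _ sys0) => s As; case: noA; exists s.
pose psi (X : finType) (t : term V X) :=
  [set x | `[< forall s, A s -> x \in extend (sval s) t >]].
have attained (X : finType) (t : term V X) :
    idem t -> exists2 s, A s & psi X t = extend (sval s) t.
  move=> ht; pose P n := `[< exists2 s, A s & #|extend (sval s) t| = n >].
  have exP : exists n, P n by exists #|extend (sval s0) t|; apply/asboolP; exists s0.
  case: (ex_minnP exP) => n /asboolP[s As sn] nmin; exists s => //.
  apply/setP => x; rewrite inE; apply/asboolP/idP => [/(_ s As) //|xs r Ar].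
  have [/asboolP rs|/asboolP sr] := Atot r s Ar As.
    exact: subsetP (rs X t ht) x xs.
  suff -> : extend (sval r) t = extend (sval s) t by [].
  apply/eqP; rewrite eqEcard sr //= sn; apply: nmin; apply/asboolP; by exists r.
have spsi : system psi.
  split=> [X t ht|X t ht|X Y p t ht|X s t hs st].
  - by have [[r sr] _ ->] := attained X t ht; apply: system_neq0.
  - by have [[r sr] _ ->] := attained X t ht; apply: system_good.
  - apply/subsetP => _ /imsetP[x + ->]; rewrite !inE => /asboolP xt.
    apply/asboolP => -[r sr] Ar.
    by apply: (subsetP (system_lax sr p ht)); apply: imset_f; apply: (xt _ Ar).
  - apply/setP => x; rewrite !inE; apply/asboolP/asboolP => xt [r sr] Ar /=.
      by rewrite -(system_sat sr hs st); apply: (xt _ Ar).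
    by rewrite (system_sat sr hs st); apply: (xt _ Ar).
exists (mk _ spsi) => s As; apply/asboolP => X t ht /=.
rewrite -(extend_restrict spsi) //; apply/subsetP => x; rewrite inE => /asboolP; exact.
Qed.

Section Minimal.
Variable phi : forall X : finType, term V X -> {set X}.
Hypothesis phi_min : minimal phi.
Arguments phi {X}.

Let sphi : system (@phi) := proj1 phi_min.

Let phi_sat (X : finType) (s t : term V X) : idem s -> V |= s ≈ t -> phi s = phi t.
Proof. exact: system_sat. Qed.

Let phi_snd_sub (X Y : finType) (f : term V X) (t : term V Y) : idem f -> idem t ->
  snd @: phi (star f t) \subset phi t.
Proof.
move=> hf ht; rewrite -(phi_sat _ (rename_snd_star t hf)).
  exact: system_lax (idem_star hf ht).
exact/idem_rename/idem_star.
Qed.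

Let phi_lax_star (X Y Z : finType) (p : Y -> Z) (f : term V X) (t : term V Y) x y :
  idem f -> idem t -> (x, y) \in phi (star f t) -> (x, p y) \in phi (star f (rename p t)).
Proof.
move=> hf ht xy; have hs := idem_star hf ht.
rewrite -(phi_sat (idem_rename _ hs) (rename_star p f t)).
by apply: (subsetP (system_lax sphi _ hs)); apply/imsetP; exists (x, y).
Qed.

Let phi_snd (X Y : finType) (f : term V X) (t : term V Y) : idem f -> idem t ->
  phi t = snd @: phi (star f t).
Proof.
move=> hf ht; apply/eqP; rewrite eqEsubset phi_snd_sub // andbT.
apply: ((proj2 phi_min) (fun Y (t : term V Y) => snd @: phi (star f t))) ht; last first.
  by move=> Z u hu; apply: phi_snd_sub.
split=> [Z u hu|Z u hu|Z W p u hu|Z u w hu uw].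
- by rewrite imset_eq0; apply: system_neq0 (idem_star hf hu).
- apply: good_satisfies (rename_snd_star u hf) _.
  by apply: good_image; apply: system_good (idem_star hf hu).
- apply/subsetP => _ /imsetP[_ /imsetP[[x z] xz ->] ->] /=.
  by apply/imsetP; exists (x, p z); rewrite ?phi_lax_star.
- by rewrite (phi_sat (idem_star hf hu) (satisfies_star_r f uw)).
Qed.

Let phi_fst (X Y : finType) (f : term V X) (t : term V Y) : idem f -> idem t ->
  phi f = fst @: phi (star f t).
Proof.
move=> hf ht.
have sub (Z : finType) (u : term V Z) : idem u -> fst @: phi (star u t) \subset phi u.
  move=> hu; have hs := idem_star hu ht.
  rewrite -(phi_sat (idem_rename _ hs) (rename_fst_star u ht)).
  exact: system_lax.
apply/eqP; rewrite eqEsubset sub // andbT.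
apply: ((proj2 phi_min) (fun X (f : term V X) => fst @: phi (star f t))) hf; last exact: sub.
split=> [Z u hu|Z u hu|Z W p u hu|Z u w hu uw].
- by rewrite imset_eq0; apply: system_neq0 (idem_star hu ht).
- apply: good_satisfies (rename_fst_star u ht) _.
  by apply: good_image; apply: system_good (idem_star hu ht).
- have hs := idem_star hu ht.
  apply/subsetP => _ /imsetP[_ /imsetP[[z y] zy ->] ->] /=.
  apply/imsetP; exists (p z, y) => //.
  rewrite -(phi_sat (idem_rename _ hs) (rename_star_l p u t)).
  by apply: (subsetP (system_lax sphi _ hs)); apply/imsetP; exists (z, y).
- by rewrite (phi_sat (idem_star hu ht) (satisfies_star_l t uw)).
Qed.

Lemma minimal_rename (X Y : finType) (p : X -> Y) (t : term V X) : idem t ->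
  phi (rename p t) = p @: phi t.
Proof.
move=> ht; apply/eqP; rewrite eqEsubset (system_lax sphi) // andbT.
have hr := idem_rename p ht; have hs := idem_star hr ht.
rewrite (phi_fst hr ht) (@good_imset_eq _ _ fst (p \o snd) (star (rename p t) t)).
- by rewrite imset_comp; apply: imsetS; apply: phi_snd_sub.
- move=> A hA v; rewrite (rename_fst_star _ ht hA).
  have := rename_snd_star t hr hA (v \o p); rewrite !eval_rename => <-.
  by congr (eval _ _).
- exact: system_good.
Qed.

Let minimal_star (X Y : finType) (f : term V X) (t : term V Y) x y : idem f -> idem t ->
  ((x, y) \in phi (star f t)) = (x \in phi f) && (y \in phi t).
Proof.
move=> hf ht; apply/idP/andP => [xy|[xf]].
  rewrite (phi_fst hf ht) [phi t](phi_snd hf ht).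
  by split; apply/imsetP; exists (x, y).
pose slice (Z : finType) (u : term V Z) := [set z | (x, z) \in phi (star f u)].
suff /subsetP/(_ y) : phi t \subset slice Y t by rewrite inE.
apply: (proj2 phi_min) ht => [|Z u hu]; last first.
  apply/subsetP => z; rewrite inE => xz; apply: (subsetP (phi_snd_sub hf hu)).
  by apply/imsetP; exists (x, z).
split=> [Z u hu|Z u hu|Z W p u hu|Z u w hu uw].
- move: xf; rewrite (phi_fst hf hu) => /imsetP[[x' z] xz /= ex].
  by apply/set0Pn; exists z; rewrite inE ex.
- move=> J K JK sJ.
  pose ex (L : {set Z}) := [set xz : X * Z | (xz.1 == x) ==> (xz.2 \in L)].
  have exJK : identified (star f u) (ex J) (ex K).
    move=> A hA v; rewrite !eval_rename !eval_star; congr (eval _ f); apply: funext => x'.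
    have [->|nx] := eqVneq x' x.
      have := JK A hA v; rewrite !eval_rename => e.
      by move: e; congr (_ = _); congr (eval _ u); apply: funext => z; rewrite /= inE eqxx.
    by congr (eval _ u); apply: funext => z; rewrite /= !inE (negPf nx).
  have sexJ : phi (star f u) \subset ex J.
    apply/subsetP => -[x' z] xz; rewrite inE /=; apply/implyP => /eqP ex'.
    by apply: (subsetP sJ); rewrite inE -ex'.
  have := system_good sphi (idem_star hf hu) exJK sexJ.
  by move=> /subsetP sK; apply/subsetP => z; rewrite inE => /sK; rewrite inE eqxx.
- apply/subsetP => _ /imsetP[z xz ->]; rewrite inE; apply: phi_lax_star => //.
  by move: xz; rewrite inE.
- by apply/setP => z; rewrite !inE (phi_sat (idem_star hf hu) (satisfies_star_r f uw)).
Qed.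

Let common_cover (X Y : finType) (g : X -> term V Y) (x0 : X) : (forall x, idem (g x)) ->
  exists (Z : finType) (t : term V Z) (p : X -> Z -> Y),
    idem t /\ forall x, V |= rename (p x) t ≈ g x.
Proof.
move=> hg.
suff cov (s : seq X) : exists (Z : finType) (t : term V Z) (p : X -> Z -> Y),
    idem t /\ forall x, x \in s -> V |= rename (p x) t ≈ g x.
  have [Z [t [p [ht hp]]]] := cov (enum X).
  by exists Z, t, p; split=> // x; apply: hp; rewrite mem_enum.
elim: s => [|x s [Z [t [p [ht hp]]]]]; first by exists Y, (g x0), (fun=> id); split.
exists (Y * Z)%type, (star (g x) t), (fun x' => if x' == x then fst else p x' \o snd).
split; first exact: idem_star.
move=> x'; rewrite in_cons; have [->|_] /= := eqVneq x' x => [_|xs A hA v].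
  exact: rename_fst_star.
have := rename_snd_star t (hg x) hA (v \o p x'); rewrite !eval_rename => e.
by rewrite -(hp x' xs A hA v) eval_rename -e; congr (eval _ _).
Qed.

Lemma minimal_subst (X Y : finType) (f : term V X) (g : X -> term V Y) y :
  idem f -> (forall x, idem (g x)) ->
  y \in phi (subst g f) <-> exists2 x, x \in phi f & y \in phi (g x).
Proof.
move=> hf hg; have [x0 _] := set0Pn _ (system_neq0 sphi hf).
have [Z [t [p [ht hp]]]] := common_cover x0 hg; have hs := idem_star hf ht.
have gE x : phi (g x) = p x @: phi t.
  by rewrite -(phi_sat _ (hp x)) ?minimal_rename //; apply: idem_rename.
have -> : phi (subst g f) = (fun xz => p xz.1 xz.2) @: phi (star f t).
  rewrite -minimal_rename //; apply: phi_sat => [|A hA v]; first exact: idem_subst.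
  rewrite eval_subst eval_rename eval_star; congr (eval _ f); apply: funext => x.
  by rewrite -(hp x A hA v) eval_rename.
split=> [/imsetP[[x z] + ->]|[x xf]].
  by rewrite minimal_star // => /andP[xf zt]; exists x => //; rewrite gE imset_f.
by rewrite gE => /imsetP[z zt ->]; apply/imsetP; exists (x, z); rewrite ?minimal_star ?xf.
Qed.

Lemma idem_var (X : Type) (x : X) : idem (Var x).
Proof. by move=> A hA v. Qed.

Lemma minimal_var (X : finType) (x : X) : phi (Var x) = [set x].
Proof.
have hx := @idem_var X x; apply/eqP; rewrite eqEsubset sub1set.
have sub : phi (Var x) \subset [set x].
  by apply: (system_good sphi hx) (subsetT _) => A hA v; rewrite /= !inE eqxx.
rewrite sub /=; have /set0Pn[y yx] := system_neq0 sphi hx.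
have := subsetP sub y yx; rewrite inE => /eqP yE.
by rewrite yE in yx.
Qed.

End Minimal.
End Terms.

(** * Interpretations in semilattices *)

Section Semilattices.

Definition mt (A : algebra semilattice_sig) (a b : A) : A := ops A tt (tnth [tuple a; b]).

Lemma pairE (T : Type) (f : 'I_2 -> T) : f = tnth [tuple f ord0; f ord_max].
Proof.
by apply: funext => -[[|[|//]] i]; rewrite (tnth_nth (f ord0)) /=; congr f; apply: val_inj.
Qed.

Lemma eval_app2 (A : algebra semilattice_sig) (X : Type) (v : X -> A) (o : semilattice_sig)
    (ts : 'I_(arity o) -> term semilattice_sig X) :
  eval v (App o ts) = mt (eval v (ts (@ord0 1))) (eval v (ts (@ord_max 1))).
Proof.
by case: o ts => ts /=; congr (ops A tt _); rewrite [LHS]pairE.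
Qed.

Lemma eval_meet (A : algebra semilattice_sig) (X : Type) (v : X -> A) s t :
  eval v (meet s t) = mt (eval v s) (eval v t).
Proof. by rewrite eval_app2. Qed.

Lemma semilatticeP (A : algebra semilattices) : in_variety A <->
  [/\ forall a : A, mt a a = a, forall a b : A, mt a b = mt b a
    & forall a b c : A, mt a (mt b c) = mt (mt a b) c].
Proof.
split=> [hA|[h1 h2 h3] e [[->|->]|->] v]; last 3 first.
- by rewrite [LHS](eval_meet v (Var 0) (Var 0)) h1.
- by rewrite [LHS](eval_meet v (Var 0) (Var 1)) h2 [RHS](eval_meet v (Var 1) (Var 0)).
- rewrite [LHS](eval_meet v (Var 0) (meet (Var 1) (Var 2))).
  by rewrite [RHS](eval_meet v (meet (Var 0) (Var 1)) (Var 2)) !eval_meet h3.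
split=> [a|a b|a b c].
- have := hA (meet (Var 0) (Var 0), Var 0) _ (fun=> a).
  by rewrite eval_meet; apply; left; left.
- have := hA (meet (Var 0) (Var 1), meet (Var 1) (Var 0)) _ (nth a [:: a; b]).
  by rewrite !eval_meet; apply; left; right.
- have := hA (meet (Var 0) (meet (Var 1) (Var 2)), meet (meet (Var 0) (Var 1)) (Var 2)) _
    (nth a [:: a; b; c]).
  by rewrite !eval_meet; apply; right.
Qed.

Definition union_alg (X : Type) : algebra semilattices :=
  @Algebra semilattices (set X)
    (fun=> fun a => (a (@ord0 1) `|` a (@ord_max 1))%classic).

Lemma union_alg_in_variety (X : Type) : in_variety (union_alg X).
Proof.
have mtE (a b : union_alg X) : mt a b = (a `|` b)%classic by [].
apply/semilatticeP; split=> *; rewrite !mtE.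
- exact: classical_sets.setUid.
- exact: classical_sets.setUC.
- exact: classical_sets.setUA.
Qed.

Definition vars (X : Type) (t : term semilattices X) : set X :=
  @eval _ (union_alg X) X (fun x => [set x]%classic) t.

Lemma vars_app (X : Type) (o : semilattices) (ts : 'I_(arity o) -> term semilattices X) :
  vars (App o ts) = (vars (ts (@ord0 1)) `|` vars (ts (@ord_max 1)))%classic.
Proof. by rewrite /vars eval_app2. Qed.

Lemma vars_subst (X Y : Type) (g : X -> term semilattices Y) t y :
  vars (subst g t) y <-> exists2 x, vars t x & vars (g x) y.
Proof.
elim: t => [x|o ts IH]; first by split=> [xy|[_ -> //]]; exists x.
rewrite (_ : subst g (App o ts) = App o (fun i => subst g (ts i))) // !vars_app.
split=> [[/IH[x xt gy]|/IH[x xt gy]]|[x [xt|xt] gy]].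
- by exists x => //; left.
- by exists x => //; right.
- by left; apply/IH; exists x.
- by right; apply/IH; exists x.
Qed.

Lemma eval_glb (A : algebra semilattices) (X : Type) (v : X -> A) t : in_variety A ->
  (forall x, vars t x -> mt (eval v t) (v x) = eval v t) /\
  (forall c, (forall x, vars t x -> mt c (v x) = c) -> mt c (eval v t) = c).
Proof.
move=> /semilatticeP[mxx mC mA]; elim: t => [x|o ts IH].
  by split=> [y <-|c /(_ x)]; [apply: mxx|apply].
have [IH0 IH0'] := IH (@ord0 1); have [IH1 IH1'] := IH (@ord_max 1).
rewrite vars_app eval_app2; split=> [x [xt|xt]|c cv].
- by rewrite mC mA [mt (v x) _]mC IH0.
- by rewrite -mA IH1.
- by rewrite mA IH0' ?IH1' // => x xt; apply: cv; [right|left].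
Qed.

Lemma satisfies_vars (X : Type) (s t : term semilattices X) :
  semilattices |= s ≈ t <-> forall x, vars s x <-> vars t x.
Proof.
split=> [st x|st A hA v].
  by rewrite /vars (st _ (@union_alg_in_variety X)).
have [[s1 s2] [t1 t2]] := (@eval_glb A X v s hA, @eval_glb A X v t hA).
have [_ mC _] := (semilatticeP A).1 hA.
transitivity (mt (eval v s) (eval v t)).
  by apply/esym/t2 => x /st; apply: s1.
by rewrite mC; apply: s2 => x /st; apply: t1.
Qed.

Lemma exists_vars (X : finType) (S : {set X}) : S != set0 ->
  exists t : term semilattices X, forall x, vars t x <-> x \in S.
Proof.
move=> /set0Pn[x0 x0S].
suff ex (s : seq X) : exists t : term semilattices X,
    forall x, vars t x <-> x \in x0 :: s.
  have [t ht] := ex (enum S); exists t => x; rewrite ht in_cons mem_enum.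
  by split=> [/predU1P[->|]|->] //; rewrite orbT.
elim: s => [|y s [t ht]].
  by exists (Var x0) => x; rewrite inE; split=> [->|/eqP].
exists (meet (Var y) t) => x; rewrite /meet vars_app !(tnth_nth t) /= !in_cons orbCA -in_cons.
split=> [[->|/ht ->]|/predU1P[->|/ht]]; rewrite ?eqxx ?orbT //; first by left.
by right.
Qed.

End Semilattices.

Section Reduct.
Variable V : variety.
Local Notation R := (full_idempotent_reduct V).

Lemma clone_compE (W : variety) n m (f : clone W n) (g : 'I_n -> clone W m) :
  clone_comp f g = cls (@satisfies W 'I_m) (subst (fun i => rep (g i)) (rep f)).
Proof.
rewrite -eval_free /clone_comp; congr (eval _ (rep f)).
by apply: funext => i; rewrite clsK.
Qed.

Lemma rep_cls (W : variety) (X : Type) (t : term W X) :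
  W |= rep (cls (@satisfies W X) t) ≈ t.
Proof. by apply/cls_satisfies; rewrite clsK. Qed.

Lemma idem_expand (X : Type) (t : term R X) : idem (expand t).
Proof.
by elim: t => [x|[n [t ht]] ts IH]; [apply: idem_var|apply: idem_subst].
Qed.

Lemma expand_subst (X Y : Type) (g : X -> term R Y) (t : term R X) :
  expand (subst g t) = subst (fun x => expand (g x)) (expand t).
Proof.
elim: t => [//|[n [t ht]] ts IH] /=.
have substA (Z : Type) (u : term V Z) (a : Z -> term V X) (b : X -> term V Y) :
    subst b (subst a u) = subst (fun z => subst b (a z)) u.
  by elim: u => //= o us IHu; congr App; apply: funext => i; apply: IHu.
by rewrite substA; congr subst; apply: funext => i; apply: IH.
Qed.

Definition reduct_alg (A : algebra V) : algebra R :=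
  @Algebra R A (fun o a => eval a (sval (projT2 o))).

Lemma eval_reduct (A : algebra V) (X : Type) (v : X -> A) (t : term R X) :
  @eval _ (reduct_alg A) X v t = eval v (expand t).
Proof.
elim: t => [//|o ts IH] /=; rewrite eval_subst.
by congr (eval _ _); apply: funext => i; apply: IH.
Qed.

Lemma reduct_satisfies (X : Type) (s t : term R X) :
  R |= s ≈ t -> V |= expand s ≈ expand t.
Proof.
move=> st A hA v; rewrite -!eval_reduct; apply: (st (reduct_alg A)) => e he w.
by rewrite !eval_reduct; apply: he.
Qed.

Lemma satisfies_reduct n (s t : term R 'I_n.+1) :
  V |= expand s ≈ expand t -> R |= s ≈ t.
Proof.
move=> st A hA v; pose g (i : 'I_n.+1) : term R nat := Var (val i).
have := hA (subst g s, subst g t) _ (fun k => v (inord k)).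
rewrite /= !eval_subst /= => h.
have vE : (fun i : 'I_n.+1 => v (inord i)) = v.
  by apply: funext => i; rewrite inord_val.
rewrite vE in h; apply: h => B hB w; rewrite /= !expand_subst !eval_subst; exact: (st B hB).
Qed.

Lemma minimal_interprets (phi : forall X : finType, term V X -> {set X}) :
  minimal phi -> interprets_in R semilattices.
Proof.
move=> mphi; have sphi := proj1 mphi.
have ex n (c : clone R n) : exists d : clone semilattices n,
    forall x, vars (rep d) x <-> x \in phi _ (expand (rep c)).
  have [t ht] := exists_vars (system_neq0 sphi (idem_expand (rep c))).
  exists (cls _ t) => x; rewrite -ht.
  by have /satisfies_vars := rep_cls t; apply.
pose Phi n c := sval (cid (ex n c)).
have PhiP n c x : vars (rep (Phi n c)) x <-> x \in phi _ (expand (rep c)).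
  exact: (svalP (cid (ex n c)) x).
have clone_eq n (d d' : clone semilattices n) :
    (forall x, vars (rep d) x <-> vars (rep d') x) -> d = d'.
  by move=> h; rewrite -[d]clsK -[d']clsK; apply/cls_satisfies/satisfies_vars.
exists Phi; split=> [n i|n m f g]; apply: clone_eq => x; rewrite PhiP.
  have /satisfies_vars -> := rep_cls (Var i : term semilattices 'I_n).
  have /reduct_satisfies e := rep_cls (Var i : term R 'I_n).
  rewrite (system_sat sphi _ e) ?(minimal_var mphi) ?inE; last exact: idem_expand.
  by split=> [/eqP|->].
rewrite !clone_compE; have /satisfies_vars -> := rep_cls
  (subst (fun i => rep (Phi m (g i))) (rep (Phi n f))).
have /reduct_satisfies e := rep_cls (subst (fun i => rep (g i)) (rep f)).
rewrite (system_sat sphi _ e); last exact: idem_expand.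
rewrite expand_subst (minimal_subst mphi _ (idem_expand _)); last first.
  by move=> i; apply: idem_expand.
by rewrite vars_subst; split=> -[i fi gi]; exists i; apply/PhiP.
Qed.

Lemma Hobby_McKenzie_term : Hobby_McKenzie V ->
  exists (X : finType) (t : term V X), idem t /\
    forall S : {set X}, S != set0 ->
      exists J K : {set X}, [/\ S \subset J, ~~ (S \subset K) & identified t J K].
Proof.
move=> hm; have [[X [t [ht t0]]]|none] :=
    pselect (exists (X : finType) (t : term V X), idem t /\ largest_good t = set0); last first.
  case: hm; have [|phi mphi] := @minimal_system V; last exact: minimal_interprets mphi.
  by move=> X t ht; apply/eqP => t0; apply: none; exists X, t.
exists X, t; split=> // S S0; apply: contrapT => noJK; case/negP: S0.
rewrite -subset0 -t0; apply: good_sub_largest => J K JK SJ.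
by apply: contrapT => /negP SK; apply: noJK; exists J, K.
Qed.

Lemma interprets_support : interprets_in R semilattices ->
  exists S : forall n, term V 'I_n.+1 -> set 'I_n.+1,
  [/\ forall n s t x, idem s -> V |= s ≈ t -> S n s x -> S n t x,
      forall n m (p : 'I_n.+1 -> 'I_m.+1) t y, idem t ->
        S m (rename p t) y <-> exists2 x, S n t x & y = p x
    & forall n x y, S n (Var x) y <-> y = x].
Proof.
case=> phi [phi_proj phi_comp].
pose app n (t : term V 'I_n.+1) (ht : idem t) : term R 'I_n.+1 :=
  @App (idempotent_sig V) _ (existT _ n.+1 (exist _ t ht)) Var.
pose cl n (t : term V 'I_n.+1) ht : clone R n.+1 := cls (@satisfies R _) (@app n t ht).
have expand_app n t ht : V |= expand (@app n t ht) ≈ t.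
  by move=> A hA v /=; rewrite eval_subst.
exists (fun n t x => exists ht : idem t, vars (rep (phi _ (cl n t ht))) x); split.
- move=> n s t x hs st [hs' sx]; have ht := idem_satisfies st hs; exists ht.
  suff -> : cl n t ht = cl n s hs' by [].
  apply/cls_satisfies/satisfies_reduct/(satisfies_trans (expand_app _ _ _)).
  exact/satisfies_sym/(satisfies_trans (expand_app _ _ _)).
- move=> n m p t y ht; have hp := idem_rename p ht.
  have e (hp' : idem (rename p t)) (ht' : idem t) :
      cl m _ hp' = clone_comp (cl n t ht') (fun i => clone_proj R (p i)).
    rewrite clone_compE; apply/cls_satisfies => A hA v.
    rewrite eval_subst (rep_cls (app n t ht') hA).
    transitivity (eval v (subst (fun i => Var (p i)) (app n t ht'))); last first.
      rewrite eval_subst; congr (eval _ _); apply: funext => i.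
      by rewrite (rep_cls (Var (p i) : term R _) hA).
    move: A hA v; apply: satisfies_reduct; rewrite expand_subst.
    by move=> A hA v /=; rewrite !eval_subst.
  have SE (hp' : idem (rename p t)) (ht' : idem t) : vars (rep (phi _ (cl m _ hp'))) y <->
      exists2 x, vars (rep (phi _ (cl n t ht'))) x & y = p x.
    rewrite (e hp' ht') phi_comp clone_compE.
    have /satisfies_vars -> := rep_cls (subst (fun i => rep (phi _ (clone_proj R (p i))))
      (rep (phi _ (cl n t ht')))).
    rewrite vars_subst; split=> -[x tx xy]; exists x => //; move: xy; rewrite phi_proj.
      by have /satisfies_vars -> := rep_cls (Var (p x) : term semilattices _).
    by move=> ->; have /satisfies_vars -> := rep_cls (Var (p x) : term semilattices _).
  split=> [[hp' /(SE _ ht)[x tx ->]]|[x [ht' tx] yE]]; first by exists x => //; exists ht.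
  by exists hp; apply/(SE hp ht'); exists x.
- move=> n x y.
  have e hx : cl n (Var x) hx = clone_proj R x.
    by apply/cls_satisfies/satisfies_reduct.
  have vE z : vars (rep (clone_proj semilattices x)) z <-> z = x.
    by have /satisfies_vars -> := rep_cls (Var x : term semilattices _).
  split=> [[hx]|->]; first by rewrite e phi_proj vE.
  by exists (@idem_var V _ x); rewrite e phi_proj vE.
Qed.

End Reduct.

(** * Compatible and free digraphs *)

Section Compatible.
Variable V : variety.

Lemma eval_subuniverse (A : algebra V) (R : A -> A -> Prop) (X : Type) (u v : X -> A) t :
  @subuniverse V (square A) (fun p => R p.1 p.2) ->
  (forall x, R (u x) (v x)) -> R (eval u t) (eval v t).
Proof.
move=> hR uv; elim: t => [//|o ts IH] /=.
exact: (hR o (fun i => (eval u (ts i), eval v (ts i)))).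
Qed.

Lemma Hobby_McKenzie_strong (G : digraph) : Hobby_McKenzie V ->
  reflexive_digraph G -> compatible V G ->
  forall a b : G, strong_equiv a b <-> extreme_equiv a b.
Proof.
move=> /Hobby_McKenzie_term[X [t [ht tstar]]] Grefl [f [hf sub]] a b.
split=> [[ab ba]|]; last first.
  elim=> [x y [xy yx]|x|x y z _ [xy yx] _ [yz zy]].
  - by split; apply: rt_step.
  - by split; apply: rt_refl.
  - by split; [apply: rt_trans xy yz|apply: rt_trans zy yx].
apply: (@strong_ext G X (fun u : X -> G => @eval V (Algebra f) X u t)) ab ba => //.
- by move=> x; apply: (eval_idem _ hf ht).
- move=> S /tstar[J [K [SJ SK JK]]]; exists J, K; split=> // x y.
  have mixE (L : {set X}) :
      mix L x y = (fun c : bool => if c then x else y) \o (fun i => i \in L) by [].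
  have := JK _ hf (fun c : bool => if c then x else y); rewrite !eval_rename.
  by rewrite -!mixE.
- by move=> u v uv; apply: (eval_subuniverse (A := Algebra f)) uv.
Qed.

Lemma radical_strong (G : digraph) (a b : G) : radical_equiv a b -> strong_equiv a b.
Proof.
have strong_trans (x y z : G) : strong_equiv x y -> strong_equiv y z -> strong_equiv x z.
  by move=> [xy yx] [yz zy]; split; [apply: rt_trans xy yz|apply: rt_trans zy yx].
have strong_sym (x y : G) : strong_equiv x y -> strong_equiv y x by case.
case=> i; elim: i a b => [|i IH] a b /=.
  elim=> [x y [xy yx]|x|x y z _ xy _ yz]; last exact: strong_trans xy yz.
    by split; apply: rt_step.
  by split; apply: rt_refl.
have step_refl (x : G) : radical_step i x x by case: i {IH} => [|i]; apply: rt_refl.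
have block (A : quot (@radical_step G i)) x y : sval A x -> sval A y -> strong_equiv x y.
  have [c AE] := svalP A; rewrite AE => cx cy; apply: strong_trans (IH _ _ cy).
  exact/strong_sym/IH.
suff ext_block (A B : quot_digraph (@radical_step G i)) : extreme_equiv A B ->
    forall x y, sval A x -> sval B y -> strong_equiv x y.
  by move=> /ext_block; apply; apply: step_refl.
elim=> [{}A {}B [[x [y [Ax By xy]]] [y' [x' [By' Ax' yx]]]] u v Au Bv|{}A|
        {}A {}B C _ AB _ BC u v Au Cv].
- apply: (strong_trans _ x); first exact: block Au Ax.
  apply: (strong_trans _ y); last exact: block By Bv.
  split; first exact: rt_step.
  have [+ _] := block B _ _ By By'; have [+ _] := block A _ _ Ax' Ax => x'x yy'.
  by apply: rt_trans yy' (rt_trans _ _ _ _ _ _ x'x); apply: rt_step.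
- exact: block.
- have [w Bw] : exists w, sval B w.
    by have [w BE] := svalP B; exists w; rewrite BE; apply: step_refl.
  exact: strong_trans (AB u w Au Bw) (BC w v Bw Cv).
Qed.

End Compatible.

Section FreeDigraph.
Variables (V : variety) (P : digraph).
Local Notation F := (free_digraph V P).
Local Notation cl := (cls (@satisfies V P)).

Lemma free_ops (X : Type) (o : V) (ts : 'I_(arity o) -> term V X) :
  ops (free_alg V X) o (fun i => cls (@satisfies V X) (ts i)) = cls (@satisfies V X) (App o ts).
Proof.
apply/cls_satisfies => A hA v /=; congr (ops A o _).
by apply: funext => i; apply: rep_cls.
Qed.

Lemma free_subuniverse :
  @subuniverse V (square (free_alg V P)) (fun p => @edge F p.1 p.2).
Proof.
by move=> o a ha B BF; apply: (proj1 BF) => i; rewrite [a i]surjective_pairing; apply: ha.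
Qed.

Lemma free_compatible : compatible V F.
Proof.
exists (ops (free_alg V P)); split; first exact: free_alg_in_variety.
exact: free_subuniverse.
Qed.

Lemma free_gen_edge (x y : P) : edge x y -> @edge F (gen V x) (gen V y).
Proof. by move=> xy B [_]; apply; exists x, y. Qed.

Lemma eval_gen (t : term V P) : eval (@gen V P) t = cl t.
Proof.
elim: t => [//|o ts IH]; rewrite -free_ops.
by rewrite [LHS]/(ops (free_alg V P) o _); congr (ops (free_alg V P) o _); apply: funext.
Qed.

Lemma free_eval_edge (X : Type) (u v : X -> P) (t : term V X) :
  (forall x, edge (u x) (v x)) -> @edge F (cl (rename u t)) (cl (rename v t)).
Proof.
move=> uv; rewrite -!eval_gen !eval_rename.
by apply: (eval_subuniverse _ free_subuniverse) => x; apply: free_gen_edge.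
Qed.

Lemma free_reflexive : reflexive_digraph P -> reflexive_digraph F.
Proof.
move=> Prefl a; rewrite -[a]clsK -eval_gen.
by apply: (eval_subuniverse _ free_subuniverse) => x; apply: free_gen_edge.
Qed.

Lemma free_edge_ind (R : F -> F -> Prop) :
  @subuniverse V (square (free_alg V P)) (fun p => R p.1 p.2) ->
  (forall x y : P, edge x y -> R (gen V x) (gen V y)) ->
  forall a b : F, edge a b -> R a b.
Proof.
by move=> hR gR a b /(_ (fun p => R p.1 p.2)); apply; split=> // _ [x [y [xy ->]]]; apply: gR.
Qed.

Lemma free_weak_idem (x : P) (u : F) : @weak_equiv F (gen V x) u ->
  exists t : term V P, idem t /\ u = cl t.
Proof.
pose R (a b : F) := V |= rename (fun=> tt) (rep a) ≈ rename (fun=> tt) (rep b).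
have edgeR (a b : F) : edge a b -> R a b.
  apply: free_edge_ind => [o c hc A hA v|y z _ A hA v].
    have repE (d : 'I_(arity o) -> free_alg V P) :
        eval v (rename (fun=> tt) (rep (ops (free_alg V P) o d))) =
        ops A o (fun i => eval v (rename (fun=> tt) (rep (d i)))).
      rewrite eval_rename (rep_cls _ hA) /=; congr (ops A o _).
      by apply: funext => i; rewrite eval_rename.
    by rewrite !repE; congr (ops A o _); apply: funext => i; apply: hc.
  by rewrite !eval_rename !(rep_cls _ hA).
have gen_idem : idem (rep (gen V x)).
  by move=> A hA v; rewrite eval_rename (rep_cls _ hA).
suff h (a b : F) : weak_equiv a b -> idem (rep a) -> idem (rep b).
  by move=> /h /(_ gen_idem) hu; exists (rep u); rewrite clsK.
elim=> [{}a {}b ab ha|//|{}a {}b c _ ab _ bc /ab/bc //].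
have {}ab : R a b by case: ab => /edgeR // ba; apply: satisfies_sym.
by move=> A hA v; rewrite -(ab A hA v); apply: ha.
Qed.

End FreeDigraph.

Section ListDigraph.
Variables (V : variety) (n k : nat) (L : seq (nat * nat)).
Hypotheses (L_bound : all (fun p => (p.1 <= n) && (p.2 <= n)) L) (L_size : size L = k.+1).

Definition list_digraph : digraph :=
  @Digraph 'I_n.+1 (fun i j => (val i, val j) \in L).

Local Notation F := (free_digraph V list_digraph).

Definition source (e : 'I_k.+1) : 'I_n.+1 := inord (nth (0, 0) L e).1.
Definition target (e : 'I_k.+1) : 'I_n.+1 := inord (nth (0, 0) L e).2.

Lemma source_target_edge e : @edge list_digraph (source e) (target e).
Proof.
have eL : nth (0, 0) L e \in L by rewrite mem_nth // L_size.
have /andP[b1 b2] := allP L_bound _ eL.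
by rewrite /= /source /target !inordK // -surjective_pairing.
Qed.

Lemma edge_source_target (i j : list_digraph) :
  edge i j -> exists e, i = source e /\ j = target e.
Proof.
move=> ij; have lt : index (val i, val j) L < k.+1 by rewrite -L_size index_mem.
by exists (Ordinal lt); rewrite /source /target /= nth_index //= !inord_val.
Qed.

Lemma free_edgeP (a b : F) : edge a b <-> exists w : term V 'I_k.+1,
  a = cls (@satisfies V _) (rename source w) /\ b = cls (@satisfies V _) (rename target w).
Proof.
split=> [|[w [-> ->]]]; last by apply: free_eval_edge => e; apply: source_target_edge.
move: a b; apply: free_edge_ind => [o c hc|i j /edge_source_target[e [-> ->]]];
  last by exists (Var e).
have [w hw] := choice hc; exists (App o w).
have renameE (p : 'I_k.+1 -> 'I_n.+1) :
    rename p (App o w) = App o (fun i => rename p (w i)) by [].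
rewrite !renameE -!free_ops.
by split; congr (ops (free_alg V _) o _); apply: funext => i; case: (hw i).
Qed.

Lemma isolated_gen (b c : 'I_n.+1) : interprets_in (full_idempotent_reduct V) semilattices ->
  (forall d : list_digraph, @edge list_digraph b d -> @edge list_digraph d b -> d = b) ->
  @extreme_equiv F (gen V b) (gen V c) -> c = b.
Proof.
move=> /interprets_support[S [S_sat S_rename S_var]] isolated.
suff inv (u v : F) : extreme_equiv u v ->
    (exists t, [/\ idem t, u = cls _ t & forall x, S n t x -> x = b]) ->
    exists t, [/\ idem t, v = cls _ t & forall x, S n t x -> x = b].
  move=> /inv[|t [ht /cls_satisfies ct Sb]].
    by exists (Var b); split=> [|//|x /S_var]; first exact: idem_var.
  by apply/Sb/(S_sat _ _ _ _ (@idem_var V _ c) ct)/S_var.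
elim=> [{}u {}v [/free_edgeP[w [uw vw]] /free_edgeP[w' [vw' uw']]] [t [ht ut Sb]]|//|
        x y z _ xy _ yz /xy/yz //].
have tw : V |= t ≈ rename source w by apply/cls_satisfies; rewrite -ut.
have tw' : V |= t ≈ rename target w' by apply/cls_satisfies; rewrite -ut.
have ww' : V |= rename target w ≈ rename source w' by apply/cls_satisfies; rewrite -vw.
have idem_inv X (p : X -> 'I_n.+1) (s : term V X) : idem (rename p s) -> idem s.
  by move=> hs A hA f; have := hs A hA f; rewrite !eval_rename.
have hw := idem_inv _ _ _ (idem_satisfies tw ht).
have hw' := idem_inv _ _ _ (idem_satisfies tw' ht).
exists (rename target w); split=> // [|x Sx]; first exact: idem_rename.
have [e we ex] := (S_rename _ _ _ _ x hw).1 Sx.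
have Sx' := S_sat _ _ _ x (idem_rename target hw) ww' Sx.
have [e' we' ex'] := (S_rename _ _ _ _ x hw').1 Sx'.
have te : source e = b.
  apply/Sb/(S_sat _ _ _ _ (idem_rename source hw) (satisfies_sym tw))/S_rename => //.
  by exists e.
have he' : target e' = b.
  apply/Sb/(S_sat _ _ _ _ (idem_rename target hw') (satisfies_sym tw'))/S_rename => //.
  by exists e'.
apply: isolated; first by rewrite -te ex; apply: source_target_edge.
by rewrite -he' ex'; apply: source_target_edge.
Qed.

End ListDigraph.

Section Extreme.
Variable G : digraph.

Lemma extreme_cls (a b : G) :
  extreme_equiv a b <-> cls (@extreme_equiv G) a = cls (@extreme_equiv G) b.
Proof.
split=> [ab|[->]]; last exact: rt_refl.
apply: eq_exist; apply/seteqP; split=> c.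
  by apply: rt_trans; apply: ext_sym.
exact: rt_trans.
Qed.

Variable A : set G.

Lemma induced_extreme (u v : induced A) : extreme_equiv u v -> extreme_equiv (sval u) (sval v).
Proof.
elim=> [x y xy|x|x y z _ xy _ yz]; first exact: rt_step.
  exact: rt_refl.
exact: rt_trans xy yz.
Qed.

Lemma extreme_induced (u v : induced A) :
  (forall a b : G, A a -> edge a b -> A b) ->
  extreme_equiv (sval u) (sval v) -> extreme_equiv u v.
Proof.
move=> A_closed.
suff lift (a b : G) : extreme_equiv a b -> forall Aa : A a,
    exists Ab : A b, @extreme_equiv (induced A) (exist _ a Aa) (exist _ b Ab).
  case: u v => [a Aa] [b Ab] /= /lift/(_ Aa)[Ab'].
  by rewrite (Prop_irrelevance Ab' Ab).
elim=> [x y [xy yx] Ax|x Ax|x y z _ xy _ yz Ax].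
- by exists (A_closed _ _ Ax xy); apply: rt_step.
- by exists Ax; apply: rt_refl.
- have [Ay xy'] := xy Ax; have [Az yz'] := yz Ay.
  by exists Az; apply: rt_trans xy' yz'.
Qed.

End Extreme.

Section Cycle.
Variables (V : variety) (m : nat).
Local Notation C := (cycle_digraph m.+1).
Local Notation F := (free_digraph V C).

Lemma cycle_path (i j : C) : clos_refl_trans C (@edge C) i j.
Proof.
have -> : j = iter (j + (m.+1 - i)) (@ordS _) i.
  apply: val_inj; have valE k : val (iter k (@ordS m.+1) i) = (i + k) %% m.+1.
    elim: k => [|k IH] /=; first by rewrite addn0 modn_small.
    by rewrite IH -addn1 modnDml addn1 addnS.
  by rewrite valE addnCA subnKC ?modnDr ?modn_small // ltnW.
elim: (_ + _) => [|k IH]; first exact: rt_refl.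
by apply: rt_trans IH _; apply: rt_step; right.
Qed.

Lemma gen_path (i j : C) : clos_refl_trans F (@edge F) (gen V i) (gen V j).
Proof.
elim: (cycle_path i j) => [x y xy|x|x y z _ xy _ yz].
- by apply: rt_step; apply: free_gen_edge.
- exact: rt_refl.
- exact: rt_trans xy yz.
Qed.

Lemma strong_cycle_component :
  (forall a b : F, strong_equiv a b -> extreme_equiv a b) ->
  cycle_component_extremely_connected V m.+1.
Proof.
move=> strong_extreme.
have C_refl : reflexive_digraph C by move=> i; left.
have F_refl := free_reflexive C_refl (V := V).
have path_weak (a b : F) : clos_refl_trans F (@edge F) a b -> weak_equiv a b.
  elim=> [x y xy|x|x y z _ xy _ yz]; first by apply: rt_step; left.
    exact: rt_refl.
  exact: rt_trans xy yz.
exists (cls (@weak_equiv F) (gen V (ord0 : C))); split=> [i|].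
  by apply: path_weak; apply: gen_path.
pose o : induced (sval (cls (@weak_equiv F) (gen V (ord0 : C)))) :=
  exist _ (gen V (ord0 : C) : F) (rt_refl _ _ _).
exists (cls _ o) => d; rewrite -[d]clsK; apply/extreme_cls/ext_sym.
apply: extreme_induced => [a b ga ab|/=]; first by apply: rt_trans ga _; apply: rt_step; left.
case: (rep d) => u /= gu; apply: strong_extreme.
have [t [ht ->]] := free_weak_idem gu.
have hF := @free_alg_in_variety V C.
rewrite -(eval_idem (gen V (ord0 : C) : free_alg V C) hF ht) -eval_gen.
have pres : preserves (fun f : 'I_m.+1 -> F => @eval V (free_alg V C) _ f t) (@edge F).
  by move=> f g fg; apply: (eval_subuniverse _ (@free_subuniverse V C)).
by split; apply: (preserves_clos F_refl pres) => i; apply: gen_path.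
Qed.

End Cycle.

Section Counterexample.

(* A double edge between 1 and 2, with 1 -> 0 -> 2: collapsing the double edge
   creates a new one, so 0 and 1 are radically equivalent. *)
Let L := [:: (0, 0); (1, 1); (2, 2); (1, 2); (2, 1); (1, 0); (0, 2)].
Local Notation P := (list_digraph 2 L).

Lemma radical_Hobby_McKenzie (V : variety) :
  (forall G : digraph, reflexive_digraph G -> compatible V G ->
     forall a b : G, radical_equiv a b -> extreme_equiv a b) ->
  Hobby_McKenzie V.
Proof.
move=> radical int; pose F := free_digraph V P.
pose g (i : 'I_3) : F := gen V (i : P).
have edgeF (i j : 'I_3) : (i : nat, j : nat) \in L -> @edge F (g i) (g j).
  exact: (@free_gen_edge V P).
have P_refl : reflexive_digraph P by case=> [[|[|[|//]]] ?].
suff : inord 1 = ord0 :> 'I_3 by move/(congr1 val); rewrite /= inordK.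
apply: (@isolated_gen V 2 6 L) => //; first by case=> [[|[|[|//]]] ?] //= _ _; apply: val_inj.
apply: ext_sym; apply: radical; [exact: free_reflexive|exact: free_compatible|].
exists 1; apply: rt_step; split.
  by exists (g (inord 1)), (g ord0); split; [apply: rt_refl..|apply: edgeF; rewrite inordK].
exists (g ord0), (g (inord 2)); split; [exact: rt_refl| |by apply: edgeF; rewrite inordK].
by apply: rt_step; split; apply: edgeF; rewrite !inordK.
Qed.

End Counterexample.

Section ThreeCycle.

(* The edges of the 3-cycle, listed so that their sources and their targets are the
   argument patterns x,x,y,y,z,z and x,y,y,z,z,x of the identities. *)
Let L := [:: (0, 0); (0, 1); (1, 1); (1, 2); (2, 2); (2, 0)].
Local Notation P := (list_digraph 2 L).
Local Notation x := (@Ordinal 3 0 isT).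
Local Notation y := (@Ordinal 3 1 isT).
Variable V : variety.
Local Notation F := (free_digraph V P).
Local Notation cl := (cls (@satisfies V P)).
Local Notation tl := (@source 2 5 L).
Local Notation hd := (@target 2 5 L).

Lemma cycle_digraph3 : cycle_digraph 3 = P.
Proof.
congr Digraph; apply: funext => i; apply: funext => j; apply: propext.
have -> : (j = i \/ j = ordS i) <-> (j == i) || (j == ordS i).
  by split=> [[/eqP->|/eqP->]|/orP[/eqP|/eqP]]; rewrite ?orbT; auto.
by case: i j => [[|[|[|//]]] ?] [[|[|[|//]]] ?].
Qed.

Lemma component_extreme : cycle_component_extremely_connected V 3 ->
  @extreme_equiv F (gen V (x : P)) (gen V (y : P)).
Proof.
rewrite /cycle_component_extremely_connected cycle_digraph3 => -[C [genC [c cE]]].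
have /extreme_cls/induced_extreme// :
  cls (@extreme_equiv (induced (sval C))) (exist _ _ (genC x)) = cls _ (exist _ _ (genC y)).
by rewrite [LHS]cE [RHS]cE.
Qed.

Lemma app6_source (t : term V 'I_6) :
  app6 t (x3 V) (x3 V) (y3 V) (y3 V) (z3 V) (z3 V) = rename tl t.
Proof.
rewrite /app6 /rename; congr (subst _ t); apply: funext => i; rewrite (tnth_nth (x3 V)).
by case: i => [[|[|[|[|[|[|//]]]]]] ?] /=; congr (Var _); apply: val_inj; rewrite /= inordK.
Qed.

Lemma app6_target (t : term V 'I_6) :
  app6 t (x3 V) (y3 V) (y3 V) (z3 V) (z3 V) (x3 V) = rename hd t.
Proof.
rewrite /app6 /rename; congr (subst _ t); apply: funext => i; rewrite (tnth_nth (x3 V)).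
by case: i => [[|[|[|[|[|[|//]]]]]] ?] /=; congr (Var _); apply: val_inj; rewrite /= inordK.
Qed.

Let edgeP (a b : F) : edge a b <-> exists w, a = cl (rename tl w) /\ b = cl (rename hd w).
Proof. exact: (@free_edgeP V 2 5 L isT erefl). Qed.

Definition HM_identities (n : nat) (s t : nat -> term V 'I_6) : Prop :=
  let x := x3 V in let y := y3 V in let z := z3 V in
  [/\ V |= app6 (t 1) x x y y z z ≈ x,
      forall i, 1 <= i <= n ->
        V |= app6 (t i) x x y y z z ≈ app6 (s i) x y y z z x,
      forall i, 1 <= i <= n ->
        V |= app6 (s i) x x y y z z ≈ app6 (t i) x y y z z x,
      forall i, 1 < i <= n ->
        V |= app6 (t i) x x y y z z ≈ app6 (t (i - 1)) x y y z z x
    & V |= y ≈ app6 (t n) x y y z z x].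

Lemma extreme_identities : @extreme_equiv F (gen V (x : P)) (gen V (y : P)) ->
  exists n, 0 < n /\ exists s t, HM_identities n s t.
Proof.
move=> /clos_relpow[n xy].
have P_refl : reflexive_digraph P by case=> [[|[|[|//]]] ?].
have F_refl := free_reflexive P_refl (V := V).
have {}xy : relpow (sympart (@edge F)) n.+1 (gen V (x : P)) (gen V (y : P)).
  by apply: relpow_mono (leqnSn n) xy => a; split.
have [c [c0 cn cE]] := relpow_path xy.
have terms i : exists w : term V 'I_6 * term V 'I_6, i < n.+1 ->
    [/\ c i = cl (rename tl w.1), c i.+1 = cl (rename hd w.1),
        c i.+1 = cl (rename tl w.2) & c i = cl (rename hd w.2)].
  case: (ltnP i n.+1) => [lt_in|_]; last by exists (Var ord0, Var ord0).
  have [/edgeP[t [ti ti']] /edgeP[s [si si']]] := cE i lt_in.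
  by exists (t, s).
have [w wE] := choice terms.
exists n.+1; split=> //; exists (fun i => (w i.-1).2), (fun i => (w i.-1).1).
split=> [|[//|i] /= lt_in|[//|i] /= lt_in|[//|[//|i]] /= lt_in|];
  rewrite ?app6_source ?app6_target; apply/cls_satisfies.
- by have [<- _ _ _] := wE 0 isT.
- by have [<- _ _ <-] := wE i lt_in.
- by have [_ <- <- _] := wE i lt_in.
- by have [<- _ _ _] := wE i.+1 lt_in; have [_ <- _ _] := wE i (ltnW lt_in).
- by have [_ <- _ _] := wE n (leqnn _).
Qed.

Lemma identities_Hobby_McKenzie n s t : 0 < n -> HM_identities n s t -> Hobby_McKenzie V.
Proof.
move=> n_gt0 [t1 ts st tt tn] int.
suff : y = x by [].
apply: (@isolated_gen V 2 5 L isT erefl) int _ _ => [[[|[|[|//]]] ?] //= _ _|].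
  exact: val_inj.
suff ht i : 0 < i <= n -> @extreme_equiv F (gen V (x : P)) (cl (rename hd (t i))).
  have -> : gen V (y : P) = cl (rename hd (t n)) by apply/cls_satisfies; rewrite -app6_target.
  by apply: ht; rewrite n_gt0 /=.
have step j : 0 < j <= n -> @extreme_equiv F (cl (rename tl (t j))) (cl (rename hd (t j))).
  move=> j_n; apply: rt_step; split; apply/edgeP; first by exists (t j).
  by exists (s j); split; apply/cls_satisfies; rewrite -app6_source -app6_target;
    [apply/satisfies_sym/st|apply: ts].
elim: i => [//|[_|i IH]] i_n.
  have -> : gen V (x : P) = cl (rename tl (t 1)).
    by apply/cls_satisfies/satisfies_sym; rewrite -app6_source.
  exact: step.
apply: rt_trans (IH _) _; first exact: ltnW.
have -> : cl (rename hd (t i.+1)) = cl (rename tl (t i.+2)); last exact: step.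
apply/cls_satisfies/satisfies_sym; rewrite -app6_source -app6_target.
by have := tt i.+2 i_n; rewrite subn1.
Qed.

End ThreeCycle.

Theorem theorem3p5 (V : variety) :
  [<-> Hobby_McKenzie V;
   forall G : digraph, reflexive_digraph G -> compatible V G ->
      forall a b : G, radical_equiv a b <-> extreme_equiv a b;
   forall G : digraph, reflexive_digraph G -> compatible V G ->
      forall a b : G, strong_equiv a b <-> extreme_equiv a b;
   forall n : nat, 0 < n -> cycle_component_extremely_connected V n;
   cycle_component_extremely_connected V 3;
   exists n : nat, 0 < n /\ exists s t : nat -> term V 'I_6,
      let x := x3 V in let y := y3 V in let z := z3 V in
      [/\ V |= app6 (t 1) x x y y z z ≈ x,
          forall i, 1 <= i <= n ->
            V |= app6 (t i) x x y y z z ≈ app6 (s i) x y y z z x,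
          forall i, 1 <= i <= n ->
            V |= app6 (s i) x x y y z z ≈ app6 (t i) x y y z z x,
          forall i, 1 < i <= n ->
            V |= app6 (t i) x x y y z z ≈ app6 (t (i - 1)) x y y z z x
        & V |= y ≈ app6 (t n) x y y z z x]].
Proof.
tfae.
- move=> HM G G_refl G_comp a b; split=> [/radical_strong|ab]; last by exists 0.
  by have [+ _] := Hobby_McKenzie_strong HM G_refl G_comp a b.
- move=> radical G; apply: Hobby_McKenzie_strong; apply: radical_Hobby_McKenzie.
  by move=> H H_refl H_comp a b; case: (radical H H_refl H_comp a b).
- move=> strong [//|m] _; apply: strong_cycle_component => a b.
  apply: (proj1 (strong _ _ _ a b)); last exact: free_compatible.
  by apply: free_reflexive => i; left.
- exact.
- by move=> /component_extreme/extreme_identities.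
- by case=> n [n_gt0 [s [t]]]; apply: identities_Hobby_McKenzie.
Qed.
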